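(* For all $z\in\mathbb{C}\setminus\{0\}$ with $|\arg z|<\pi$, $$\frac{1}{1+W(z)}=\frac{1}{\pi}\int_0^\pi\frac{dv}{1+z\,e^{v\cot v}\,\frac{\sin v}{v}}$$ and $$\frac{1}{W(z)}=\frac{1}{z}+\frac{1}{\pi}\int_0^\pi\frac{v^2+(1-v\cot v)^2}{v\csc(v)\left(v\csc(v)+z\,e^{v\cot v}\right)}\,dv .$$
   Context: $W$ denotes the principal branch of the Lambert $W$ function: the unique holomorphic function on $\mathbb{C}\setminus(-\infty,-1/e]$ with $W(z)e^{W(z)}=z$ and $W(0)=0$. $|\arg z|<\pi$ means $z\in\mathbb{C}\setminus(-\infty,0]$. *)

(* Defs.v *)
From Stdlib Require Import Reals.
From Coquelicot Require Import Coquelicot.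
Open Scope R_scope.

Definition cot (v : R) : R := cos v / sin v.
Definition csc (v : R) : R := 1 / sin v.

Definition Cexp (z : C) : C :=
  (exp (Re z) * cos (Im z), exp (Re z) * sin (Im z)).

(* The set C \ (-oo, a], with (-oo, a] on the real axis. *)
Definition slit_plane (a : R) (z : C) : Prop := ~ (Im z = 0 /\ Re z <= a).

(* Differentiability is complex: both normed modules are over C. *)
Definition holomorphic_on (D : C -> Prop) (f : C -> C) : Prop :=
  forall z : C, D z -> @ex_derive C_AbsRing C_NormedModule f z.

(* These conditions determine W on the slit plane C \ (-oo, -1/e];
   its values on the cut (-oo, -1/e] are left arbitrary. *)
Definition is_principal_LambertW (W : C -> C) : Prop :=
  holomorphic_on (slit_plane (- (1 / exp 1))) W /\
  (forall z : C, slit_plane (- (1 / exp 1)) z -> (W z * Cexp (W z))%C = z) /\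
  W (RtoC 0) = RtoC 0.

Definition C_Rintegrable (f : R -> C) (a b : R) : Prop :=
  @ex_RInt C_R_NormedModule f a b.
Definition C_RInt (f : R -> C) (a b : R) : C :=
  @RInt C_R_CompleteNormedModule f a b.

(* The integrands below have removable singularities at v = 0 and v = PI;
   the values that total division gives there affect neither Riemann
   integrability on [0, PI] nor the integral. *)
Definition integrand1 (z : C) (v : R) : C :=
  (RtoC 1 / (RtoC 1 + z * RtoC (exp (v * cot v)) * RtoC (sin v / v)))%C.

Definition integrand2 (z : C) (v : R) : C :=
  (RtoC (v ^ 2 + (1 - v * cot v) ^ 2)
   / (RtoC (v * csc v) * (RtoC (v * csc v) + z * RtoC (exp (v * cot v)))))%C.

(* Main.v *)
Require Import Defs.
From Stdlib Require Import Reals Lra Classical ClassicalEpsilon.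
From Coquelicot Require Import Coquelicot.
Open Scope R_scope.

(** Write w = W(z), so that z = w e^w. Along the curve x(v) = - v cot v + i v
    with - PI < v < PI one has x e^x = - 1 / tau(v), where
    tau(v) = e^(v cot v) sin v / v. This curve is the boundary of the range of W,
    and both integrands are built from
    1 / (1 + z tau(v)) = x e^x / (x e^x - z), which has in the region to the right
    of the curve a single pole, at x = w.

    Residues are avoided by a choice of weight. Since x = (v / sin v) e^(i (PI - v)),
    the symmetry v -> - v leaves of dx only i dv, and of dx / x only - i dv. Hence
    (a + b / x) dx leaves i (a - b) dv for every a and b, and the weight
    (1 - w / x) dx leaves i (1 + w) dv while cancelling the pole. The integral of
    1 / (1 + z tau) over (0, PI) is thereby 1 / (2 i (1 + w)) times the integral
    along the curve of kernel1(x) = (x - w) e^x / (x e^x - w e^w), which is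
    holomorphic on the region. This integral does not change when the curve is
    replaced by the vertical chord joining x(v) to x(-v); as v tends to PI the
    chord moves off to the right, where kernel1 tends to 1, and its length tends
    to 2 PI. So the integral of kernel1 is 2 PI i, which is the first formula.

    For the second formula the weight (1 + x)(x - w) / (w x^2) dx leaves
    i |1 + x|^2 / |x|^2 dv, which is the numerator of the second integrand. It
    creates a simple pole at 0. Subtracting 1 / (z x) gives kernel2, which is
    holomorphic and tends to 1 / w on the right, and the subtracted term accounts
    for 1 / z.

    Three facts carry the argument. A function that is holomorphic on a set
    star-shaped about 0 has there the primitive obtained by integrating along
    segments from 0 (prim_deriv), which gives the change of contour
    (prim_gap_deriv, prim_gap_mean_value). The map x -> x e^x is injective on the
    closed region to the right of the curve over the complement of the slit
    (mul_exp_inj), which makes the two kernels holomorphic there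
    (slope_neq_0). And W(z) belongs to this region (lambert_in_region), because
    x e^x maps the curve into the slit, so the path t -> W(t z) from 0 cannot
    cross it. *)

(** * Calculus of complex-valued functions by components *)

(** Taken by components, so that real differentiation applies to each of them. *)
Definition deriv_C (f : R -> C) (t : R) (l : C) : Prop :=
  is_derive (fun s => Re (f s)) t (Re l) /\ is_derive (fun s => Im (f s)) t (Im l).

Definition cont_C {T : UniformSpace} (f : T -> C) (x : T) : Prop :=
  continuous (fun s => Re (f s)) x /\ continuous (fun s => Im (f s)) x.

Lemma cont_C_continuous {T : UniformSpace} (f : T -> C) (x : T) :
  cont_C f x -> continuous f x.
Proof.
  intros [H1 H2].
  apply (continuous_ext (fun s => (Re (f s), Im (f s)))).
  { intros s. unfold Re, Im. symmetry. apply surjective_pairing. }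
  apply (continuous_comp_2 (fun s => Re (f s)) (fun s => Im (f s)) (fun a b => (a, b)) x H1 H2).
  apply (continuous_ext (fun p => p)).
  { intros [a b]; reflexivity. }
  apply continuous_id.
Qed.

Lemma continuous_cont_C {T : UniformSpace} (f : T -> C) (x : T) :
  continuous f x -> cont_C f x.
Proof.
  intros H; split.
  - apply (continuous_comp f (fun p : C => fst p)); [exact H | apply continuous_fst].
  - apply (continuous_comp f (fun p : C => snd p)); [exact H | apply continuous_snd].
Qed.

Lemma cont_C_comp {T : UniformSpace} (f : T -> C) (g : C -> C) (x : T) :
  cont_C f x -> cont_C g (f x) -> cont_C (fun s => g (f s)) x.
Proof.
  intros Hf [H1 H2]. apply cont_C_continuous in Hf.
  split.
  - apply (continuous_comp f (fun p => Re (g p))); assumption.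
  - apply (continuous_comp f (fun p => Im (g p))); assumption.
Qed.

Lemma cont_C_const {T : UniformSpace} (a : C) (x : T) : cont_C (fun _ => a) x.
Proof. split; apply continuous_const. Qed.

Lemma cont_C_plus {T : UniformSpace} (f g : T -> C) (x : T) :
  cont_C f x -> cont_C g x -> cont_C (fun s => f s + g s)%C x.
Proof.
  intros [H1 H2] [H3 H4]; split; simpl.
  - apply (continuous_plus (fun s => Re (f s)) (fun s => Re (g s))); assumption.
  - apply (continuous_plus (fun s => Im (f s)) (fun s => Im (g s))); assumption.
Qed.

Lemma cont_C_opp {T : UniformSpace} (f : T -> C) (x : T) :
  cont_C f x -> cont_C (fun s => - f s)%C x.
Proof.
  intros [H1 H2]; split; simpl.
  - apply (continuous_opp (fun s => Re (f s))); assumption.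
  - apply (continuous_opp (fun s => Im (f s))); assumption.
Qed.

Lemma cont_C_minus {T : UniformSpace} (f g : T -> C) (x : T) :
  cont_C f x -> cont_C g x -> cont_C (fun s => f s - g s)%C x.
Proof. intros; apply cont_C_plus; [|apply cont_C_opp]; assumption. Qed.

Lemma cont_C_mult {T : UniformSpace} (f g : T -> C) (x : T) :
  cont_C f x -> cont_C g x -> cont_C (fun s => f s * g s)%C x.
Proof.
  intros [H1 H2] [H3 H4]; split; simpl.
  - apply (continuous_minus (fun s => Re (f s) * Re (g s)) (fun s => Im (f s) * Im (g s)));
    [apply (continuous_mult (fun s => Re (f s)) (fun s => Re (g s)))
    |apply (continuous_mult (fun s => Im (f s)) (fun s => Im (g s)))]; assumption.
  - apply (continuous_plus (fun s => Re (f s) * Im (g s)) (fun s => Im (f s) * Re (g s)));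
    [apply (continuous_mult (fun s => Re (f s)) (fun s => Im (g s)))
    |apply (continuous_mult (fun s => Im (f s)) (fun s => Re (g s)))]; assumption.
Qed.

Lemma Csq_neq_0 (z : C) : z <> 0%C -> Re z * Re z + Im z * Im z <> 0.
Proof.
  intros H E. apply H. destruct z as [a b]; simpl in E.
  assert (a = 0) by nra. assert (b = 0) by nra. subst. reflexivity.
Qed.

Lemma Cinv_Re (z : C) : Re (/ z)%C = Re z * / (Re z * Re z + Im z * Im z).
Proof.
  destruct z as [a b]; unfold Cinv; simpl. unfold Rdiv. now rewrite !Rmult_1_r.
Qed.
Lemma Cinv_Im (z : C) : Im (/ z)%C = - Im z * / (Re z * Re z + Im z * Im z).
Proof.
  destruct z as [a b]; unfold Cinv; simpl. unfold Rdiv. now rewrite !Rmult_1_r.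
Qed.

Lemma cont_C_inv {T : UniformSpace} (f : T -> C) (x : T) :
  cont_C f x -> f x <> 0%C -> cont_C (fun s => / f s)%C x.
Proof.
  intros [H1 H2] H0. apply Csq_neq_0 in H0.
  assert (Hd : continuous (fun s => / (Re (f s) * Re (f s) + Im (f s) * Im (f s))) x).
  { apply (continuous_comp (fun s => Re (f s) * Re (f s) + Im (f s) * Im (f s)) Rinv).
    - apply (continuous_plus (fun s => Re (f s) * Re (f s)) (fun s => Im (f s) * Im (f s)));
      [apply (continuous_mult (fun s => Re (f s)) (fun s => Re (f s)))
      |apply (continuous_mult (fun s => Im (f s)) (fun s => Im (f s)))]; assumption.
    - apply continuous_Rinv, H0. }
  split.
  - apply (continuous_ext (fun s => Re (f s) * / (Re (f s) * Re (f s) + Im (f s) * Im (f s)))).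
    { intros s. symmetry. apply Cinv_Re. }
    apply (continuous_mult (fun s => Re (f s)) _); assumption.
  - apply (continuous_ext (fun s => - Im (f s) * / (Re (f s) * Re (f s) + Im (f s) * Im (f s)))).
    { intros s. symmetry. apply Cinv_Im. }
    apply (continuous_mult (fun s => - Im (f s)) _); [apply (continuous_opp (fun s => Im (f s)))|]; assumption.
Qed.

Lemma deriv_C_const (a : C) (t : R) : deriv_C (fun _ => a) t 0%C.
Proof. split; apply @is_derive_const. Qed.

Lemma deriv_C_plus (f g : R -> C) (t : R) (a b : C) :
  deriv_C f t a -> deriv_C g t b -> deriv_C (fun s => f s + g s)%C t (a + b)%C.
Proof.
  intros [H1 H2] [H3 H4]; split; simpl.
  - apply (is_derive_plus (fun s => Re (f s)) (fun s => Re (g s))); assumption.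
  - apply (is_derive_plus (fun s => Im (f s)) (fun s => Im (g s))); assumption.
Qed.

Lemma deriv_C_opp (f : R -> C) (t : R) (a : C) :
  deriv_C f t a -> deriv_C (fun s => - f s)%C t (- a)%C.
Proof.
  intros [H1 H2]; split; simpl.
  - apply (is_derive_opp (fun s => Re (f s))); assumption.
  - apply (is_derive_opp (fun s => Im (f s))); assumption.
Qed.

Lemma deriv_C_minus (f g : R -> C) (t : R) (a b : C) :
  deriv_C f t a -> deriv_C g t b -> deriv_C (fun s => f s - g s)%C t (a - b)%C.
Proof. intros; apply deriv_C_plus; [|apply deriv_C_opp]; assumption. Qed.

Lemma is_derive_val (f : R -> R) (x l l' : R) :
  is_derive f x l -> l = l' -> is_derive f x l'.
Proof. intros H <-; exact H. Qed.

Lemma deriv_C_val (f : R -> C) (t : R) (l l' : C) : deriv_C f t l -> l = l' -> deriv_C f t l'.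
Proof. intros H <-; exact H. Qed.

Lemma deriv_C_mult (f g : R -> C) (t : R) (a b : C) :
  deriv_C f t a -> deriv_C g t b -> deriv_C (fun s => f s * g s)%C t (a * g t + f t * b)%C.
Proof.
  intros [H1 H2] [H3 H4].
  set (p := fun s => Re (f s)). set (q := fun s => Im (f s)).
  change (is_derive p t (Re a)) in H1. change (is_derive q t (Im a)) in H2.
  set (r := fun s => Re (g s)). set (u := fun s => Im (g s)).
  change (is_derive r t (Re b)) in H3. change (is_derive u t (Im b)) in H4.
  assert (D1 : Derive (fun x => p x) t = Re a) by exact (is_derive_unique _ _ _ H1). assert (D2 : Derive (fun x => q x) t = Im a) by exact (is_derive_unique _ _ _ H2).
  assert (D3 : Derive (fun x => r x) t = Re b) by exact (is_derive_unique _ _ _ H3). assert (D4 : Derive (fun x => u x) t = Im b) by exact (is_derive_unique _ _ _ H4).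
  split.
  - apply (is_derive_val (fun s => p s * r s - q s * u s) t
             (Re a * r t + p t * Re b - (Im a * u t + q t * Im b))).
    + auto_derive.
      * repeat split; eexists; eassumption.
      * rewrite D1, D2, D3, D4. ring.
    + unfold p, q, r, u. destruct a, b, (f t), (g t); simpl; ring.
  - apply (is_derive_val (fun s => p s * u s + q s * r s) t
             (Re a * u t + p t * Im b + (Im a * r t + q t * Re b))).
    + auto_derive.
      * repeat split; eexists; eassumption.
      * rewrite D1, D2, D3, D4. ring.
    + unfold p, q, r, u. destruct a, b, (f t), (g t); simpl; ring.
Qed.

Lemma deriv_C_inv (f : R -> C) (t : R) (a : C) :
  deriv_C f t a -> f t <> 0%C -> deriv_C (fun s => / f s)%C t (- a / (f t * f t))%C.
Proof.
  intros [H1 H2] H0. assert (N := Csq_neq_0 _ H0).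
  set (p := fun s => Re (f s)). set (q := fun s => Im (f s)).
  change (is_derive p t (Re a)) in H1. change (is_derive q t (Im a)) in H2.
  assert (D1 : Derive (fun x => p x) t = Re a) by exact (is_derive_unique _ _ _ H1). assert (D2 : Derive (fun x => q x) t = Im a) by exact (is_derive_unique _ _ _ H2).
  change (p t * p t + q t * q t <> 0) in N.
  set (n := p t * p t + q t * q t) in *.
  assert (E : (- a / (f t * f t) = - a * (((p t / n)%R, (- q t / n)%R) * ((p t / n)%R, (- q t / n)%R)))%C).
  { assert (E : (/ f t = ((p t / n)%R, (- q t / n)%R))%C).
    { apply injective_projections; [apply Cinv_Re | apply Cinv_Im]. }
    rewrite <- E. field. exact H0. }
  rewrite E. split.
  - apply (is_derive_ext (fun s => p s * / (p s * p s + q s * q s))).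
    { intros s. symmetry. apply Cinv_Re. }
    auto_derive.
    + repeat split; try (eexists; eassumption). exact N.
    + rewrite D1, D2. clear - N. unfold n in *. clear n. generalize dependent (q t).
      generalize (p t). destruct a. intros; simpl. field. exact N.
  - apply (is_derive_ext (fun s => - q s * / (p s * p s + q s * q s))).
    { intros s. symmetry. apply Cinv_Im. }
    auto_derive.
    + repeat split; try (eexists; eassumption). exact N.
    + rewrite D1, D2. clear - N. unfold n in *. clear n. generalize dependent (q t).
      generalize (p t). destruct a. intros; simpl. field. exact N.
Qed.

Lemma deriv_C_cont (f : R -> C) (t : R) (l : C) : deriv_C f t l -> cont_C f t.
Proof.
  intros [H1 H2]; split; apply @ex_derive_continuous; eexists; eassumption.
Qed.

(** Compactness of [0, 1]: finitely many of the two-dimensional neighbourhoods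
    cover the segment, and the smallest of their radii works for all of it. *)
Lemma tube_lemma (P : R -> R -> Prop) (x : R) :
  (forall t, 0 <= t <= 1 -> locally_2d P x t) ->
  locally x (fun u => forall t, 0 <= t <= 1 -> P u t).
Proof.
  intros H.
  assert (Hd : forall t, exists d : posreal, 0 <= t <= 1 ->
     forall u v, Rabs (u - x) < d -> Rabs (v - t) < d -> P u v).
  { intros t. destruct (classic (0 <= t <= 1)) as [Ht|Ht].
    - destruct (H t Ht) as [d Hd]. exists d. intros _. exact Hd.
    - exists (mkposreal 1 Rlt_0_1). intros C; contradiction. }
  set (delta := fun t => proj1_sig (constructive_indefinite_description _ (Hd t))).
  destruct (compactness_value_1d 0 1 delta) as [d Hc].
  exists d. intros u Hu t Ht.
  apply NNPP. intros HP. apply (Hc t Ht). intros (s & Hs & H1 & H2).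
  apply HP. unfold delta in *.
  destruct (constructive_indefinite_description _ (Hd s)) as [e He]; simpl in *.
  apply (He Hs); [|exact H1].
  eapply Rlt_le_trans; [exact Hu | exact H2].
Qed.

(** The hypotheses are local at each point of the segment; the tube lemma makes
    them uniform in t, as differentiation under the integral sign requires. *)
Lemma derive_int01 (f df : R -> R -> R) (x : R) :
  (forall t, 0 <= t <= 1 -> locally_2d (fun u s => is_derive (fun r => f r s) u (df u s)) x t) ->
  (forall t, 0 <= t <= 1 -> continuity_2d_pt df x t) ->
  (forall t, 0 <= t <= 1 -> locally_2d (fun u s => continuous (f u) s) x t) ->
  is_derive (fun u => RInt (f u) 0 1) x (RInt (df x) 0 1).
Proof.
  intros H1 H2 H3.
  assert (Hm : Rmin 0 1 = 0) by (apply Rmin_left; lra).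
  assert (HM : Rmax 0 1 = 1) by (apply Rmax_right; lra).
  eapply is_derive_val.
  - apply (is_derive_RInt_param f 0 1 x).
    + rewrite Hm, HM. generalize (tube_lemma _ _ H1). apply filter_imp.
      intros u Hu t Ht. eexists. apply Hu, Ht.
    + rewrite Hm, HM. intros t Ht.
      apply (continuity_2d_pt_ext_loc df); [|apply H2, Ht].
      generalize (H1 t Ht). apply locally_2d_impl, locally_2d_forall.
      intros u v Huv. symmetry. apply is_derive_unique, Huv.
    + generalize (tube_lemma _ _ H3). apply filter_imp. intros u Hu.
      apply (ex_RInt_continuous (V := R_CompleteNormedModule)). rewrite Hm, HM. apply Hu.
  - apply RInt_ext. rewrite Hm, HM. intros t Ht.
    apply is_derive_unique.
    exact (locally_2d_singleton _ _ _ (H1 t (conj (Rlt_le _ _ (proj1 Ht)) (Rlt_le _ _ (proj2 Ht))))).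
Qed.

(** * Integration over the unit interval and primitives *)

Definition int01 (f : R -> C) : C :=
  (RInt (fun s => Re (f s)) 0 1, RInt (fun s => Im (f s)) 0 1).

(** The integral of g along the segment from 0 to x. *)
Definition prim (g : C -> C) (x : C) : C := int01 (fun s => x * g (RtoC s * x))%C.

(** Holomorphy tested along curves: for products, inverses and compositions the
    verification takes place in one real variable. The continuity of g' is what
    differentiation under the integral sign consumes. *)
Definition hol_with (D : C -> Prop) (g g' : C -> C) : Prop :=
  forall x, D x -> cont_C g x /\ cont_C g' x /\
    forall c t l, c t = x -> deriv_C c t l -> deriv_C (fun s => g (c s)) t (g' x * l)%C.

Lemma cont_C_RtoC {T : UniformSpace} (f : T -> R) (x : T) :
  continuous f x -> cont_C (fun s => RtoC (f s)) x.
Proof. intros H; split; [exact H | apply continuous_const]. Qed.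

Lemma deriv_C_RtoC (f : R -> R) (t l : R) :
  is_derive f t l -> deriv_C (fun s => RtoC (f s)) t (RtoC l).
Proof. intros H; split; [exact H | exact (@is_derive_const R_AbsRing R_NormedModule 0 t)]. Qed.

Lemma deriv_C_id (t : R) : deriv_C RtoC t 1%C.
Proof. apply (deriv_C_RtoC (fun r => r)), @is_derive_id. Qed.

Lemma int01_deriv (f df : R -> C) :
  (forall s, 0 <= s <= 1 -> deriv_C f s (df s)) ->
  (forall s, 0 <= s <= 1 -> cont_C df s) ->
  int01 df = (f 1 - f 0)%C.
Proof.
  intros H1 H2.
  assert (Hm : Rmin 0 1 = 0) by (apply Rmin_left; lra).
  assert (HM : Rmax 0 1 = 1) by (apply Rmax_right; lra).
  apply injective_projections; apply is_RInt_unique.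
  - apply (is_RInt_derive (V := R_CompleteNormedModule) (fun r => Re (f r)) (fun s => Re (df s)));
    rewrite Hm, HM; intros s Hs; [apply (H1 s Hs) | apply (H2 s Hs)].
  - apply (is_RInt_derive (V := R_CompleteNormedModule) (fun r => Im (f r)) (fun s => Im (df s)));
    rewrite Hm, HM; intros s Hs; [apply (H1 s Hs) | apply (H2 s Hs)].
Qed.

Lemma deriv_C_int01 (F dF : R -> R -> C) (v : R) :
  (forall t, 0 <= t <= 1 ->
     locally_2d (fun u s => deriv_C (fun r => F r s) u (dF u s) /\ cont_C (F u) s) v t) ->
  (forall t, 0 <= t <= 1 -> @cont_C (prod_UniformSpace R_UniformSpace R_UniformSpace)
                   (fun p => dF (fst p) (snd p)) (v, t)) ->
  deriv_C (fun u => int01 (F u)) v (int01 (dF v)).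
Proof.
  intros HF CdF. split.
  - apply (derive_int01 (fun u s => Re (F u s)) (fun u s => Re (dF u s))); intros t Ht.
    + generalize (HF t Ht). apply locally_2d_impl, locally_2d_forall.
      intros u s [[A _] _]; exact A.
    + apply continuity_2d_pt_filterlim. apply (proj1 (CdF t Ht)).
    + generalize (HF t Ht). apply locally_2d_impl, locally_2d_forall.
      intros u s [_ [A _]]; exact A.
  - apply (derive_int01 (fun u s => Im (F u s)) (fun u s => Im (dF u s))); intros t Ht.
    + generalize (HF t Ht). apply locally_2d_impl, locally_2d_forall.
      intros u s [[_ A] _]; exact A.
    + apply continuity_2d_pt_filterlim. apply (proj2 (CdF t Ht)).
    + generalize (HF t Ht). apply locally_2d_impl, locally_2d_forall.
      intros u s [_ [_ A]]; exact A.
Qed.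

Lemma cont_C_comp_R {T : UniformSpace} (f : T -> R) (h : R -> C) (x : T) :
  continuous f x -> cont_C h (f x) -> cont_C (fun p => h (f p)) x.
Proof.
  intros Hf [A B]; split.
  - apply (continuous_comp f (fun y => Re (h y))); assumption.
  - apply (continuous_comp f (fun y => Im (h y))); assumption.
Qed.

(** Cauchy's theorem in the form of a primitive. Along the curve, c g(s c) has the
    derivative c' g(s c) + s c c' g'(s c), which is also the derivative in s of
    s c' g(s c); so its integral over [0, 1] is g(c) c'. *)
Lemma prim_deriv (D : C -> Prop) (g g' : C -> C) (c c' : R -> C) (v : R) :
  open D -> hol_with D g g' ->
  locally v (fun u => deriv_C c u (c' u)) -> cont_C c' v ->
  (forall s, 0 <= s <= 1 -> D (RtoC s * c v)%C) ->
  deriv_C (fun u => prim g (c u)) v (g (c v) * c' v)%C.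
Proof.
  intros HO Hg Hc Hc' HD.
  set (F := fun u s => (c u * g (RtoC s * c u))%C).
  set (dF := fun u s => (c' u * g (RtoC s * c u) + c u * (g' (RtoC s * c u) * (RtoC s * c' u)))%C).
  assert (Cc : cont_C c v) by (exact (deriv_C_cont _ _ _ (locally_singleton _ _ Hc))).
  assert (Harg : forall t, @cont_C (prod_UniformSpace R_UniformSpace R_UniformSpace)
                   (fun p => RtoC (snd p) * c (fst p))%C (v, t)).
  { intros t. apply cont_C_mult.
    - apply cont_C_RtoC, continuous_snd.
    - apply (cont_C_comp_R fst c); [apply continuous_fst | exact Cc]. }
  assert (CdF : forall t, 0 <= t <= 1 -> @cont_C (prod_UniformSpace R_UniformSpace R_UniformSpace)
                   (fun p => dF (fst p) (snd p)) (v, t)).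
  { intros t Ht. destruct (Hg _ (HD t Ht)) as (G1 & G2 & _).
    assert (Cfst : forall h : R -> C, cont_C h v -> @cont_C (prod_UniformSpace R_UniformSpace R_UniformSpace)
       (fun p => h (fst p)) (v, t)).
    { intros h Hh. apply (cont_C_comp_R fst h); [apply continuous_fst | exact Hh]. }
    unfold dF. apply cont_C_plus; apply cont_C_mult.
    - apply Cfst, Hc'.
    - apply (cont_C_comp (fun p => RtoC (snd p) * c (fst p))%C g); [apply Harg | exact G1].
    - apply Cfst, Cc.
    - apply cont_C_mult.
      + apply (cont_C_comp (fun p => RtoC (snd p) * c (fst p))%C g'); [apply Harg | exact G2].
      + apply cont_C_mult; [apply cont_C_RtoC, continuous_snd | apply Cfst, Hc']. }
  apply (deriv_C_val (fun u => int01 (F u)) v (int01 (dF v))).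
  - apply deriv_C_int01; [|exact CdF].
    intros t Ht. apply locally_2d_locally.
    assert (A1 : locally (v, t) (fun p : R * R => D (RtoC (snd p) * c (fst p))%C)).
    { apply (cont_C_continuous _ _ (Harg t)). simpl. apply HO, HD, Ht. }
    assert (A2 : locally (v, t) (fun p : R * R => deriv_C c (fst p) (c' (fst p)))).
    { exact (continuous_fst (v : R_UniformSpace) (t : R_UniformSpace) (fun u => deriv_C c u (c' u)) Hc). }
    generalize (filter_and _ _ A1 A2). apply filter_imp.
    intros [u s] [B1 B2]; simpl in *.
    destruct (Hg _ B1) as (G1 & G2 & G3).
    split.
    + eapply deriv_C_val.
      * apply (deriv_C_mult c (fun r => g (RtoC s * c r)%C)); [exact B2|].
        apply (G3 (fun r => RtoC s * c r)%C u (0 * c u + RtoC s * c' u)%C eq_refl).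
        apply (deriv_C_mult (fun _ => RtoC s) c); [apply deriv_C_const | exact B2].
      * unfold dF. ring.
    + apply cont_C_mult; [apply cont_C_const|].
      apply (cont_C_comp (fun r => RtoC r * c u)%C g); [|exact G1].
      apply cont_C_mult; [apply cont_C_RtoC, continuous_id | apply cont_C_const].
  - (* dF v s is also the derivative in s of s c'(v) g (s c(v)) *)
    rewrite (int01_deriv (fun r => RtoC r * c' v * g (RtoC r * c v))%C (dF v)).
    + replace (RtoC 1 * c v)%C with (c v) by ring. ring.
    + intros s Hs. destruct (Hg _ (HD s Hs)) as (_ & _ & G3).
      eapply deriv_C_val.
      * apply (deriv_C_mult (fun r => RtoC r * c' v)%C (fun r => g (RtoC r * c v)%C)).
        -- apply (deriv_C_mult RtoC (fun _ => c' v)); [apply deriv_C_id | apply deriv_C_const].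
        -- apply (G3 (fun r => RtoC r * c v)%C s (1 * c v + RtoC s * 0)%C eq_refl).
           apply (deriv_C_mult RtoC (fun _ => c v)); [apply deriv_C_id | apply deriv_C_const].
      * unfold dF. ring.
    + intros s Hs. destruct (Hg _ (HD s Hs)) as (G1 & G2 & _).
      assert (Hsc : cont_C (fun r : R => RtoC r * c v)%C s)
        by (apply cont_C_mult; [apply cont_C_RtoC, continuous_id | apply cont_C_const]).
      unfold dF. apply cont_C_plus; apply cont_C_mult; try apply cont_C_const.
      * apply (cont_C_comp (fun r => RtoC r * c v)%C g); assumption.
      * apply cont_C_mult; [apply (cont_C_comp (fun r => RtoC r * c v)%C g'); assumption|].
        apply cont_C_mult; [apply cont_C_RtoC, continuous_id | apply cont_C_const].
Qed.

(** * The complex exponential *)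

Lemma Cexp_plus (x y : C) : Cexp (x + y) = (Cexp x * Cexp y)%C.
Proof.
  destruct x as [a b], y as [c d]; unfold Cexp; simpl.
  rewrite exp_plus, cos_plus, sin_plus.
  apply injective_projections; simpl; ring.
Qed.

Lemma Cexp_0 : Cexp 0 = 1%C.
Proof. unfold Cexp; simpl. rewrite exp_0, cos_0, sin_0. apply injective_projections; simpl; ring. Qed.

Lemma Cexp_inv (x : C) : (Cexp (- x) * Cexp x)%C = 1%C.
Proof. rewrite <- Cexp_plus, <- Cexp_0. f_equal. ring. Qed.

Lemma Cexp_neq_0 (x : C) : Cexp x <> 0%C.
Proof.
  intros E. assert (H := Cexp_inv x). rewrite E, Cmult_0_r in H.
  apply C1_nz. now rewrite <- H.
Qed.

Lemma Cmod_Cexp (x : C) : Cmod (Cexp x) = exp (Re x).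
Proof.
  unfold Cmod, Cexp; simpl fst; simpl snd.
  replace ((exp (Re x) * cos (Im x)) ^ 2 + (exp (Re x) * sin (Im x)) ^ 2)
    with (exp (Re x) * exp (Re x) * (Rsqr (sin (Im x)) + Rsqr (cos (Im x))))
    by (unfold Rsqr; ring).
  rewrite sin2_cos2, Rmult_1_r. apply sqrt_square, Rlt_le, exp_pos.
Qed.

Lemma Cmod_le_Re_Im (z : C) : Cmod z <= Rabs (Re z) + Rabs (Im z).
Proof.
  destruct z as [a b]; unfold Cmod; simpl.
  assert (Ha := Rabs_pos a). assert (Hb := Rabs_pos b).
  rewrite <- (sqrt_square (Rabs a + Rabs b)) by lra.
  apply sqrt_le_1_alt.
  assert (Ea : a * a = Rabs a * Rabs a) by (rewrite <- Rabs_mult, Rabs_pos_eq; nra).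
  assert (Eb : b * b = Rabs b * Rabs b) by (rewrite <- Rabs_mult, Rabs_pos_eq; nra).
  nra.
Qed.

Lemma Im_le_Cmod (z : C) : Rabs (Im z) <= Cmod z.
Proof.
  destruct z as [a b]; unfold Cmod; simpl.
  rewrite <- (sqrt_square (Rabs b)) by apply Rabs_pos.
  apply sqrt_le_1_alt. rewrite <- Rabs_mult, Rabs_pos_eq; nra.
Qed.

Lemma abs_sin_le (x : R) : Rabs (sin x) <= Rabs x.
Proof.
  destruct (MVT_gen sin 0 x cos) as (y & _ & Hy).
  - intros y _. apply is_derive_Reals, derivable_pt_lim_sin.
  - intros y _. apply continuity_sin.
  - rewrite sin_0 in Hy. replace (sin x) with (cos y * x) by lra.
    rewrite Rabs_mult. assert (A := COS_bound y).
    assert (Rabs (cos y) <= 1) by (apply Rabs_le; lra).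
    assert (B := Rabs_pos x). nra.
Qed.

Lemma one_minus_cos (b : R) : Rabs (cos b - 1) <= b * b / 2.
Proof.
  replace b with (2 * (b / 2)) at 1 by field. rewrite cos_2a_sin.
  assert (H := abs_sin_le (b / 2)).
  assert (H2 : sin (b / 2) * sin (b / 2) <= (b / 2) * (b / 2)) by (apply Rsqr_le_abs_1 in H; exact H).
  rewrite Rabs_left1; nra.
Qed.

Lemma sin_minus_id (b : R) : Rabs b <= 1 -> Rabs (sin b - b) <= b * b.
Proof.
  intros Hb.
  destruct (MVT_gen (fun x => sin x - x) 0 b (fun x => cos x - 1)) as (x & Hx & E).
  - intros x _. auto_derive; [trivial | ring].
  - intros x _. apply continuity_pt_minus; [apply continuity_sin | apply continuity_pt_id].
  - rewrite sin_0 in E. replace (sin b - b) with ((cos x - 1) * (b - 0)) by lra.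
    rewrite Rabs_mult, Rminus_0_r.
    assert (A := one_minus_cos x).
    assert (B : Rabs x <= Rabs b).
    { unfold Rmin, Rmax in Hx. destruct (Rle_dec 0 b).
      - rewrite !Rabs_pos_eq; lra.
      - rewrite !Rabs_left1; lra. }
    assert (C1 : x * x <= Rabs b).
    { replace (x * x) with (Rabs x * Rabs x) by (rewrite <- Rabs_mult; apply Rabs_pos_eq; nra).
      assert (B0 := Rabs_pos x). nra. }
    replace (b * b) with (Rabs b * Rabs b) by (rewrite <- Rabs_mult; apply Rabs_pos_eq; nra).
    assert (B0 := Rabs_pos b). apply Rmult_le_compat_r; nra.
Qed.

Lemma exp_quad_bound (a : R) : Rabs a <= 1 / 2 -> 0 <= exp a - 1 - a <= 2 * (a * a).
Proof.
  intros Ha. apply Rabs_le_between in Ha. split.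
  - assert (H := exp_ineq1_le a). lra.
  - assert (H := exp_ineq1_le (- a)).
    assert (E : exp a * exp (- a) = 1) by (rewrite <- exp_plus, Rplus_opp_r; apply exp_0).
    assert (P := exp_pos a).
    assert (Q : exp a * (1 - a) <= 1) by (rewrite <- E; apply Rmult_le_compat_l; lra).
    assert (S : (1 + a + 2 * (a * a)) * (1 - a) >= 1).
    { assert (0 <= a * a * (1 - 2 * a)) by (apply Rmult_le_pos; [apply Rle_0_sqr | lra]).
      replace ((1 + a + 2 * (a * a)) * (1 - a)) with (1 + a * a * (1 - 2 * a)) by ring. lra. }
    apply (Rplus_le_reg_r (1 + a)), (Rmult_le_reg_r (1 - a)); lra.
Qed.

(** Only the order of the bound matters; 4 collects crude estimates of the two
    components. *)
Lemma Cexp_quad_bound (h : C) : Cmod h <= 1 / 2 -> Cmod (Cexp h - 1 - h)%C <= 4 * Cmod h ^ 2.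
Proof.
  intros Hh.
  assert (H1 := re_le_Cmod h). assert (H2 := Im_le_Cmod h).
  rewrite Cmod2_alt.
  eapply Rle_trans; [apply Cmod_le_Re_Im|].
  destruct h as [a b]; unfold Cexp; simpl in *.
  assert (Ea := exp_quad_bound a ltac:(lra)).
  assert (Eb := one_minus_cos b). assert (Es := sin_minus_id b ltac:(lra)).
  assert (Ha : Rabs a <= 1 / 2) by lra. assert (Hb : Rabs b <= 1 / 2) by lra.
  assert (Sa : Rabs a * Rabs a = a * a) by (rewrite <- Rabs_mult; apply Rabs_pos_eq; nra).
  assert (Sb : Rabs b * Rabs b = b * b) by (rewrite <- Rabs_mult; apply Rabs_pos_eq; nra).
  assert (Pa := Rabs_pos a). assert (Pb := Rabs_pos b).
  assert (E1 : Rabs (exp a - 1) <= 2 * Rabs a).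
  { replace (exp a - 1) with ((exp a - 1 - a) + a) by ring.
    eapply Rle_trans; [apply Rabs_triang|]. rewrite (Rabs_pos_eq (exp a - 1 - a)); nra. }
  assert (E2 : exp a <= 2) by (apply Rabs_le_between in E1; lra).
  assert (E3 : Rabs (sin b) <= Rabs b + b * b).
  { replace (sin b) with ((sin b - b) + b) by ring.
    eapply Rle_trans; [apply Rabs_triang|]. lra. }
  assert (R1 : Rabs (exp a * cos b + -(1) + - a) <= 2 * (a * a) + b * b).
  { replace (exp a * cos b + -(1) + - a) with ((exp a - 1 - a) + exp a * (cos b - 1)) by ring.
    eapply Rle_trans; [apply Rabs_triang|].
    rewrite Rabs_mult, (Rabs_pos_eq (exp a)) by (apply Rlt_le, exp_pos).
    rewrite (Rabs_pos_eq (exp a - 1 - a)) by lra.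
    assert (P := exp_pos a). assert (P2 := Rabs_pos (cos b - 1)). nra. }
  assert (R2 : Rabs (exp a * sin b + - 0 + - b) <= 2 * Rabs a * (Rabs b + b * b) + b * b).
  { replace (exp a * sin b + - 0 + - b) with ((exp a - 1) * sin b + (sin b - b)) by ring.
    eapply Rle_trans; [apply Rabs_triang|].
    rewrite Rabs_mult. assert (P := Rabs_pos (exp a - 1)). assert (P2 := Rabs_pos (sin b)).
    nra. }
  assert (R3 : 2 * Rabs a * (Rabs b + b * b) <= a * a + 2 * (b * b)).
  { assert (Sq := Rle_0_sqr (Rabs a - Rabs b)). unfold Rsqr in Sq.
    assert (2 * Rabs a * Rabs b <= a * a + b * b) by lra.
    assert (2 * Rabs a * (b * b) <= 1 * (b * b)) by (apply Rmult_le_compat_r; [apply Rle_0_sqr | lra]). lra. }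
  nra.
Qed.

(** * Quadratic approximation and the chain rule *)

Lemma deriv_C_bound (c : R -> C) (t : R) (l : C) : deriv_C c t l ->
  forall eps, 0 < eps -> exists d : posreal, forall s, Rabs s < d ->
    Cmod (c (t + s)%R - c t - RtoC s * l)%C <= eps * Rabs s.
Proof.
  intros [H1 H2] eps Heps.
  apply is_derive_Reals in H1. apply is_derive_Reals in H2.
  destruct (H1 (eps / 2) ltac:(lra)) as [d1 D1]. destruct (H2 (eps / 2) ltac:(lra)) as [d2 D2].
  assert (Hd : 0 < Rmin d1 d2) by (apply Rmin_pos; [apply d1 | apply d2]).
  exists (mkposreal _ Hd). simpl. intros s Hs.
  destruct (Req_dec s 0) as [->|Hs0].
  { rewrite Rplus_0_r, Rabs_R0, Rmult_0_r.
    replace (c t - c t - RtoC 0 * l)%C with (RtoC 0) by ring. rewrite Cmod_0. lra. }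
  specialize (D1 s Hs0 (Rlt_le_trans _ _ _ Hs (Rmin_l _ _))).
  specialize (D2 s Hs0 (Rlt_le_trans _ _ _ Hs (Rmin_r _ _))).
  assert (P : 0 < Rabs s) by (apply Rabs_pos_lt, Hs0).
  assert (K : forall x y, Rabs ((x - y) / s) < eps / 2 -> forall z, z = x - y -> Rabs z <= eps / 2 * Rabs s).
  { intros x y Hxy z ->. replace (x - y) with ((x - y) / s * s) by (field; exact Hs0).
    rewrite Rabs_mult. apply Rmult_le_compat_r; lra. }
  eapply Rle_trans; [apply Cmod_le_Re_Im|].
  replace (eps * Rabs s) with (eps / 2 * Rabs s + eps / 2 * Rabs s) by field.
  apply Rplus_le_compat.
  - apply (K (Re (c (t + s)%R) - Re (c t)) (s * Re l)).
    + replace ((Re (c (t + s)%R) - Re (c t) - s * Re l) / s) with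
        ((Re (c (t + s)%R) - Re (c t)) / s - Re l) by (field; exact Hs0). exact D1.
    + destruct l, (c (t + s)%R), (c t); simpl; ring.
  - apply (K (Im (c (t + s)%R) - Im (c t)) (s * Im l)).
    + replace ((Im (c (t + s)%R) - Im (c t) - s * Im l) / s) with
        ((Im (c (t + s)%R) - Im (c t)) / s - Im l) by (field; exact Hs0). exact D2.
    + destruct l, (c (t + s)%R), (c t); simpl; ring.
Qed.

Lemma bound_deriv_C (c : R -> C) (t : R) (l : C) :
  (forall eps, 0 < eps -> exists d : posreal, forall s, Rabs s < d ->
    Cmod (c (t + s)%R - c t - RtoC s * l)%C <= eps * Rabs s) -> deriv_C c t l.
Proof.
  intros H; split; apply is_derive_Reals; intros eps Heps;
  destruct (H (eps / 2) ltac:(lra)) as [d D]; exists d; intros s Hs0 Hs; specialize (D s Hs);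
  assert (P : 0 < Rabs s) by (apply Rabs_pos_lt, Hs0);
  apply (Rmult_lt_reg_r (Rabs s)); try exact P; rewrite <- Rabs_mult.
  - replace (((Re (c (t + s)%R) - Re (c t)) / s - Re l) * s) with (Re (c (t + s)%R - c t - RtoC s * l)%C).
    + eapply Rle_lt_trans; [apply re_le_Cmod|]. nra.
    + destruct l, (c (t + s)%R), (c t); simpl; field; exact Hs0.
  - replace (((Im (c (t + s)%R) - Im (c t)) / s - Im l) * s) with (Im (c (t + s)%R - c t - RtoC s * l)%C).
    + eapply Rle_lt_trans; [apply Im_le_Cmod|]. nra.
    + destruct l, (c (t + s)%R), (c t); simpl; field; exact Hs0.
Qed.

(** The radius 1/2 is the one on which the exponential is estimated. *)
Definition quad_approx (g : C -> C) (x l : C) : Prop :=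
  exists M, 0 <= M /\ forall h, Cmod h <= 1 / 2 ->
    Cmod (g (x + h) - g x - h * l)%C <= M * Cmod h ^ 2.

(** The remainder is quadratic in the increment of the curve, hence negligible
    against the increment of the parameter. *)
Lemma quad_approx_deriv (g : C -> C) (x l : C) (c : R -> C) (t : R) (l' : C) :
  quad_approx g x l -> c t = x -> deriv_C c t l' -> deriv_C (fun s => g (c s)) t (l * l')%C.
Proof.
  intros (M & HM & Hg) <- Hc. apply bound_deriv_C. intros eps Heps.
  set (A := Cmod l' + 1).
  assert (PA : 1 <= A) by (unfold A; assert (P := Cmod_ge_0 l'); lra).
  assert (Pl := Cmod_ge_0 l).
  set (e1 := Rmin 1 (eps / (2 * (Cmod l + 1)))).
  assert (Pe0 : 0 < eps / (2 * (Cmod l + 1))) by (apply Rdiv_lt_0_compat; lra).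
  assert (Pe : 0 < e1) by (apply Rmin_pos; [lra | exact Pe0]).
  destruct (deriv_C_bound c t l' Hc e1 Pe) as [d Hd].
  set (d2 := Rmin d (Rmin (1 / (2 * A)) (eps / (2 * (M * (A * A) + 1))))).
  assert (PMA : 0 <= M * (A * A)) by (apply Rmult_le_pos; nra).
  assert (Pd2 : 0 < d2).
  { repeat apply Rmin_pos; [apply d | apply Rdiv_lt_0_compat; lra | apply Rdiv_lt_0_compat; lra]. }
  exists (mkposreal _ Pd2). simpl. intros s Hs.
  assert (S1 : Rabs s < d) by (eapply Rlt_le_trans; [exact Hs | apply Rmin_l]).
  assert (S2 : Rabs s <= 1 / (2 * A)).
  { apply Rlt_le. eapply Rlt_le_trans; [exact Hs|]. eapply Rle_trans; [apply Rmin_r | apply Rmin_l]. }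
  assert (S3 : Rabs s <= eps / (2 * (M * (A * A) + 1))).
  { apply Rlt_le. eapply Rlt_le_trans; [exact Hs|]. eapply Rle_trans; [apply Rmin_r | apply Rmin_r]. }
  specialize (Hd s S1). set (h := (c (t + s)%R - c t)%C) in *.
  assert (Ps := Rabs_pos s).
  assert (Hh : Cmod h <= A * Rabs s).
  { replace h with ((h - RtoC s * l') + RtoC s * l')%C by ring.
    eapply Rle_trans; [apply Cmod_triangle|]. rewrite Cmod_mult, Cmod_R.
    assert (e1 <= 1) by apply Rmin_l. unfold A. nra. }
  assert (Hh2 : Cmod h <= 1 / 2).
  { eapply Rle_trans; [exact Hh|]. replace (1 / 2) with (A * (1 / (2 * A))) by (field; lra).
    apply Rmult_le_compat_l; lra. }
  specialize (Hg h Hh2). replace (c t + h)%C with (c (t + s)%R) in Hg by (unfold h; ring).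
  replace (g (c (t + s)%R) - g (c t) - RtoC s * (l * l'))%C with
    ((g (c (t + s)%R) - g (c t) - h * l) + l * (h - RtoC s * l'))%C by ring.
  eapply Rle_trans; [apply Cmod_triangle|]. rewrite Cmod_mult.
  assert (B1 : M * Cmod h ^ 2 <= eps / 2 * Rabs s).
  { apply Rle_trans with (M * (A * A) * Rabs s * Rabs s).
    - assert (Cmod h ^ 2 <= A * Rabs s * (A * Rabs s)).
      { simpl. rewrite Rmult_1_r. apply Rmult_le_compat; try apply Cmod_ge_0; exact Hh. }
      replace (M * (A * A) * Rabs s * Rabs s) with (M * (A * Rabs s * (A * Rabs s))) by ring.
      apply Rmult_le_compat_l; assumption.
    - apply Rmult_le_compat_r; [exact Ps|].
      apply Rle_trans with ((M * (A * A) + 1) * (eps / (2 * (M * (A * A) + 1)))).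
      + apply Rmult_le_compat; lra.
      + right. field. lra. }
  assert (B2 : Cmod l * Cmod (h - RtoC s * l')%C <= eps / 2 * Rabs s).
  { apply Rle_trans with (Cmod l * (e1 * Rabs s)); [apply Rmult_le_compat_l; assumption|].
    rewrite <- Rmult_assoc. apply Rmult_le_compat_r; [exact Ps|].
    apply Rle_trans with ((Cmod l + 1) * (eps / (2 * (Cmod l + 1)))).
    - apply Rmult_le_compat; try lra. apply Rmin_r.
    - right. field. lra. }
  lra.
Qed.

(** Balls of the product topology of C are squares; discs give the same
    neighbourhoods. *)
Lemma locally_Cmod (x : C) (P : C -> Prop) :
  (exists d : posreal, forall h, Cmod h < d -> P (x + h)%C) -> locally x P.
Proof.
  intros [d H].
  assert (Hd : 0 < d / 2) by (assert (A := cond_pos d); lra).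
  exists (mkposreal _ Hd). intros y [H1 H2]. replace y with (x + (y - x))%C by ring.
  apply H. eapply Rle_lt_trans; [apply Cmod_le_Re_Im|].
  destruct x as [a b], y as [u v].
  change (Rabs (u - a) < d / 2) in H1. change (Rabs (v - b) < d / 2) in H2.
  simpl. unfold Rminus in *. lra.
Qed.

Lemma locally_Cmod_inv (x : C) (P : C -> Prop) :
  locally x P -> exists d : posreal, forall h, Cmod h < d -> P (x + h)%C.
Proof.
  intros [d H]. exists d. intros h Hh. apply H.
  assert (H1 := re_le_Cmod h). assert (H2 := Im_le_Cmod h).
  destruct x as [a b], h as [u v]. simpl in *.
  split.
  - change (Rabs (a + u - a) < d). replace (a + u - a) with u by ring. lra.
  - change (Rabs (b + v - b) < d). replace (b + v - b) with v by ring. lra.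
Qed.

Lemma quad_approx_cont (g : C -> C) (x l : C) : quad_approx g x l -> cont_C g x.
Proof.
  intros (M & HM & Hg). apply continuous_cont_C.
  apply filterlim_locally. intros eps.
  assert (Pl := Cmod_ge_0 l).
  assert (Pd : 0 < Rmin (1 / 2) (eps / (M + Cmod l + 1))).
  { apply Rmin_pos; [lra | apply Rdiv_lt_0_compat; [apply eps | lra]]. }
  apply locally_Cmod. exists (mkposreal _ Pd). simpl. intros h Hh.
  assert (H1 : Cmod h <= 1 / 2) by (apply Rlt_le; eapply Rlt_le_trans; [exact Hh | apply Rmin_l]).
  assert (H2 : Cmod h < eps / (M + Cmod l + 1)) by (eapply Rlt_le_trans; [exact Hh | apply Rmin_r]).
  specialize (Hg h H1). assert (P := Cmod_ge_0 h).
  assert (K : Cmod (g (x + h) - g x)%C < eps).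
  { replace (g (x + h) - g x)%C with ((g (x + h) - g x - h * l) + h * l)%C by ring.
    eapply Rle_lt_trans; [apply Cmod_triangle|]. rewrite Cmod_mult.
    apply Rle_lt_trans with ((M + Cmod l + 1) * Cmod h).
    - simpl in Hg. assert (M * (Cmod h * (Cmod h * 1)) <= M * Cmod h) by (apply Rmult_le_compat_l; nra). nra.
    - apply (Rmult_lt_compat_l (M + Cmod l + 1)) in H2; [|lra].
      replace ((M + Cmod l + 1) * (eps / (M + Cmod l + 1))) with (pos eps) in H2 by (field; lra).
      exact H2. }
  set (p := g (x + h)%C) in *. set (q := g x) in *.
  assert (K1 := re_le_Cmod (p - q)%C). assert (K2 := Im_le_Cmod (p - q)%C).
  destruct p as [a b], q as [u v]. simpl in K1, K2.
  split; [change (Rabs (a - u) < eps) | change (Rabs (b - v) < eps)]; unfold Rminus; lra.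
Qed.

(** * Moments of the exponential *)

Lemma exp_mono (a b : R) : a <= b -> exp a <= exp b.
Proof. intros [H|<-]; [apply Rlt_le, exp_increasing, H | right; reflexivity]. Qed.

Lemma ex_RInt_01 (f : R -> R) : (forall s, continuous f s) -> ex_RInt f 0 1.
Proof. intros H. apply (ex_RInt_continuous (V := R_CompleteNormedModule)). intros; apply H. Qed.

Lemma int01_ext (f g : R -> C) : (forall s, f s = g s) -> int01 f = int01 g.
Proof.
  intros H. apply injective_projections; simpl; apply RInt_ext; intros s _; now rewrite H.
Qed.

Lemma int01_minus (f g : R -> C) : (forall s, cont_C f s) -> (forall s, cont_C g s) ->
  int01 (fun s => f s - g s)%C = (int01 f - int01 g)%C.
Proof.
  intros Hf Hg. apply injective_projections; simpl.
  - apply (RInt_minus (V := R_CompleteNormedModule) (fun s => Re (f s)) (fun s => Re (g s)));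
    apply ex_RInt_01; intros s; [apply Hf | apply Hg].
  - apply (RInt_minus (V := R_CompleteNormedModule) (fun s => Im (f s)) (fun s => Im (g s)));
    apply ex_RInt_01; intros s; [apply Hf | apply Hg].
Qed.

Lemma int01_scal (a : C) (f : R -> C) : (forall s, cont_C f s) ->
  int01 (fun s => a * f s)%C = (a * int01 f)%C.
Proof.
  intros Hf.
  assert (H1 : ex_RInt (fun s => Re (f s)) 0 1) by (apply ex_RInt_01; intros s; apply Hf).
  assert (H2 : ex_RInt (fun s => Im (f s)) 0 1) by (apply ex_RInt_01; intros s; apply Hf).
  apply (RInt_correct (V := R_CompleteNormedModule)) in H1.
  apply (RInt_correct (V := R_CompleteNormedModule)) in H2.
  apply injective_projections; simpl; apply is_RInt_unique.
  - apply (is_RInt_minus (V := R_NormedModule) (fun s => Re a * Re (f s)) (fun s => Im a * Im (f s))).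
    + apply (is_RInt_scal (V := R_NormedModule) (fun s => Re (f s)) 0 1 (Re a)), H1.
    + apply (is_RInt_scal (V := R_NormedModule) (fun s => Im (f s)) 0 1 (Im a)), H2.
  - apply (is_RInt_plus (V := R_NormedModule) (fun s => Re a * Im (f s)) (fun s => Im a * Re (f s))).
    + apply (is_RInt_scal (V := R_NormedModule) (fun s => Im (f s)) 0 1 (Re a)), H2.
    + apply (is_RInt_scal (V := R_NormedModule) (fun s => Re (f s)) 0 1 (Im a)), H1.
Qed.

Lemma int01_bound (f : R -> C) (M : R) : (forall s, cont_C f s) ->
  (forall s, 0 <= s <= 1 -> Cmod (f s) <= M) -> Cmod (int01 f) <= 2 * M.
Proof.
  intros Hf HM.
  assert (K : forall h : R -> R, (forall s, continuous h s) ->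
     (forall s, 0 <= s <= 1 -> Rabs (h s) <= M) -> Rabs (RInt h 0 1) <= M).
  { intros h Hh Hb. replace M with ((1 - 0) * M) by ring.
    apply (norm_RInt_le_const (V := R_NormedModule) h 0 1 (RInt h 0 1) M); [lra | exact Hb |].
    apply (RInt_correct (V := R_CompleteNormedModule)), ex_RInt_01, Hh. }
  eapply Rle_trans; [apply Cmod_le_Re_Im|]. simpl.
  assert (K1 : Rabs (RInt (fun s => Re (f s)) 0 1) <= M).
  { apply K; [intros s; apply Hf | intros s Hs].
    eapply Rle_trans; [apply re_le_Cmod | apply HM, Hs]. }
  assert (K2 : Rabs (RInt (fun s => Im (f s)) 0 1) <= M).
  { apply K; [intros s; apply Hf | intros s Hs].
    eapply Rle_trans; [apply Im_le_Cmod | apply HM, Hs]. }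
  lra.
Qed.

Lemma Cexp_quad_approx (x : C) : quad_approx Cexp x (Cexp x).
Proof.
  exists (4 * Cmod (Cexp x)). assert (P := Cmod_ge_0 (Cexp x)). split; [lra|].
  intros h Hh. rewrite Cexp_plus.
  replace (Cexp x * Cexp h - Cexp x - h * Cexp x)%C with (Cexp x * (Cexp h - 1 - h))%C by ring.
  rewrite Cmod_mult. assert (Q := Cexp_quad_bound h Hh). nra.
Qed.

(** For j = 0 this is (e^x - 1) / x with its singularity at 0 removed, and
    raising j by one differentiates. *)
Definition exp_moment (j : nat) (x : C) : C := int01 (fun s => RtoC (s ^ j) * Cexp (RtoC s * x))%C.

Lemma exp_moment_integrand_cont (j : nat) (x : C) (s : R) : cont_C (fun s => RtoC (s ^ j) * Cexp (RtoC s * x))%C s.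
Proof.
  apply cont_C_mult.
  - apply cont_C_RtoC. apply @ex_derive_continuous. auto_derive. trivial.
  - apply (cont_C_comp (fun s => RtoC s * x)%C Cexp); [|eapply quad_approx_cont, Cexp_quad_approx].
    apply cont_C_mult; [apply cont_C_RtoC, continuous_id | apply cont_C_const].
Qed.

(** The remainder of e^(s x) under an increment h of x is
    e^(s x) (e^(s h) - 1 - s h), which is quadratic in h uniformly for s in [0, 1]. *)
Lemma exp_moment_quad_approx (j : nat) (x : C) : quad_approx (exp_moment j) x (exp_moment (S j) x).
Proof.
  exists (8 * exp (Cmod x)). assert (P := exp_pos (Cmod x)). split; [lra|].
  intros h Hh. unfold exp_moment.
  rewrite <- int01_scal by apply exp_moment_integrand_cont.
  rewrite <- int01_minus; [|intros; apply exp_moment_integrand_cont..].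
  rewrite <- int01_minus.
  2: intros; apply cont_C_minus; apply exp_moment_integrand_cont.
  2: intros; apply cont_C_mult; [apply cont_C_const | apply exp_moment_integrand_cont].
  replace (8 * exp (Cmod x) * Cmod h ^ 2) with (2 * (exp (Cmod x) * (4 * Cmod h ^ 2))) by ring.
  apply int01_bound.
  { intros s. apply cont_C_minus; [apply cont_C_minus; apply exp_moment_integrand_cont |].
    apply cont_C_mult; [apply cont_C_const | apply exp_moment_integrand_cont]. }
  intros s Hs.
  replace (RtoC (s ^ j) * Cexp (RtoC s * (x + h)) - RtoC (s ^ j) * Cexp (RtoC s * x) -
           h * (RtoC (s ^ S j) * Cexp (RtoC s * x)))%C
    with (RtoC (s ^ j) * (Cexp (RtoC s * x) * (Cexp (RtoC s * h) - 1 - RtoC s * h)))%C.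
  2:{ rewrite Cmult_plus_distr_l, Cexp_plus. simpl pow. rewrite RtoC_mult. ring. }
  rewrite !Cmod_mult, Cmod_R, Cmod_Cexp.
  assert (Hj : 0 <= s ^ j <= 1).
  { split; [apply pow_le; lra|]. rewrite <- (pow1 j). apply pow_incr. lra. }
  rewrite Rabs_pos_eq by lra.
  assert (Ps := Cmod_ge_0 h).
  assert (Hsh : Cmod (RtoC s * h)%C = s * Cmod h) by (rewrite Cmod_mult, Cmod_R, Rabs_pos_eq; lra).
  assert (Q := Cexp_quad_bound (RtoC s * h)%C ltac:(rewrite Hsh; nra)).
  rewrite Hsh in Q.
  assert (Q2 : 4 * (s * Cmod h) ^ 2 <= 4 * Cmod h ^ 2).
  { simpl. assert (s * Cmod h <= Cmod h) by nra. assert (0 <= s * Cmod h) by nra. nra. }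
  assert (Q3 : exp (Re (RtoC s * x)%C) <= exp (Cmod x)).
  { assert (R1 := re_le_Cmod (RtoC s * x)%C). rewrite Cmod_mult, Cmod_R, (Rabs_pos_eq s) in R1 by lra.
    assert (R2 := Rle_abs (Re (RtoC s * x)%C)). assert (R3 := Cmod_ge_0 x).
    apply exp_mono. nra. }
  assert (Q4 := exp_pos (Re (RtoC s * x)%C)).
  assert (Q5 := Cmod_ge_0 (Cexp (RtoC s * h) - 1 - RtoC s * h)%C).
  rewrite <- (Rmult_1_l (exp (Cmod x) * _)).
  apply Rmult_le_compat; [lra | apply Rmult_le_pos; lra | lra |].
  apply Rmult_le_compat; lra.
Qed.

Lemma exp_moment_cont (j : nat) (x : C) : cont_C (exp_moment j) x.
Proof. eapply quad_approx_cont, exp_moment_quad_approx. Qed.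

Lemma exp_moment_deriv (j : nat) (c : R -> C) (t : R) (l : C) :
  deriv_C c t l -> deriv_C (fun s => exp_moment j (c s)) t (exp_moment (S j) (c t) * l)%C.
Proof. intros H. eapply quad_approx_deriv; [apply exp_moment_quad_approx | reflexivity | exact H]. Qed.

Lemma mul_exp_moment_0 (x : C) : (x * exp_moment 0 x)%C = (Cexp x - 1)%C.
Proof.
  unfold exp_moment. rewrite <- int01_scal by apply exp_moment_integrand_cont.
  rewrite (int01_deriv (fun s => Cexp (RtoC s * x))).
  - replace (RtoC 1 * x)%C with x by ring. replace (RtoC 0 * x)%C with (RtoC 0) by ring.
    now rewrite Cexp_0.
  - intros s _.
    apply (deriv_C_val (fun s => Cexp (RtoC s * x)) s (Cexp (RtoC s * x) * (1 * x + RtoC s * 0))%C).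
    + apply (quad_approx_deriv Cexp _ _ (fun s => RtoC s * x)%C s _ (Cexp_quad_approx _) eq_refl).
      apply (deriv_C_mult RtoC (fun _ => x)); [apply deriv_C_id | apply deriv_C_const].
    + simpl pow. ring.
  - intros s _. apply cont_C_mult; [apply cont_C_const | apply exp_moment_integrand_cont].
Qed.

(** * Injectivity of x e^x *)

(** With v = Im x <> 0 the inequality says Re x >= - v cot v, so that off the real
    axis this is the part of the strip on or to the right of the curve
    - v cot v + i v. The real axis belongs to the set entirely. *)
Definition region (x : C) : Prop :=
  - PI < Im x < PI /\ 0 <= Im x * (Re x * sin (Im x) + Im x * cos (Im x)).

Lemma Re_mul_exp (x : C) :
  Re (x * Cexp x)%C = exp (Re x) * (Re x * cos (Im x) - Im x * sin (Im x)).
Proof. destruct x as [u v]; unfold Cexp; simpl. ring. Qed.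

Lemma Im_mul_exp (x : C) :
  Im (x * Cexp x)%C = exp (Re x) * (Re x * sin (Im x) + Im x * cos (Im x)).
Proof. destruct x as [u v]; unfold Cexp; simpl. ring. Qed.

Lemma region_conj (x : C) : region x -> region (Cconj x).
Proof.
  destruct x as [u v]; unfold region; simpl. intros [H1 H2].
  rewrite sin_neg, cos_neg. split; [lra | nra].
Qed.

(** With x = u + i v, the inequality at l x asks that v cot (l v) >= - u, and
    cot (l v) >= cot v because cot decreases on (0, PI); after multiplication by
    the sines the latter is sin (v - l v) >= 0. *)
Lemma region_star (l : R) (x : C) : 0 <= l <= 1 -> region x -> region (RtoC l * x)%C.
Proof.
  intros Hl.
  assert (K : forall u v, 0 < v < PI -> 0 <= u * sin v + v * cos v ->
            0 <= u * sin (l * v) + v * cos (l * v)).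
  { intros u v Hv H.
    assert (Sv : 0 < sin v) by (apply sin_gt_0; lra).
    assert (Slv : 0 <= sin (l * v)) by (apply sin_ge_0; nra).
    assert (S1 : 0 <= sin (v - l * v)) by (apply sin_ge_0; nra).
    rewrite sin_minus in S1.
    apply (Rmult_le_reg_l (sin v)); [exact Sv|]. rewrite Rmult_0_r.
    replace (sin v * (u * sin (l * v) + v * cos (l * v))) with
      ((u * sin v + v * cos v) * sin (l * v) + v * (sin v * cos (l * v) - cos v * sin (l * v))) by ring.
    apply Rplus_le_le_0_compat; apply Rmult_le_pos; lra. }
  destruct x as [u v]; unfold region; simpl. intros [H1 H2].
  replace (l * u - 0 * v) with (l * u) by ring. replace (l * v + 0 * u) with (l * v) by ring.
  split; [nra|].
  replace (l * v * (l * u * sin (l * v) + l * v * cos (l * v))) with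
    (l * l * (v * (u * sin (l * v) + v * cos (l * v)))) by ring.
  apply Rmult_le_pos; [nra|].
  destruct (Rtotal_order v 0) as [N|[Z|P]].
  - assert (0 <= u * sin (l * - v) + - v * cos (l * - v)).
    { apply K; [lra|]. rewrite sin_neg, cos_neg. nra. }
    replace (l * - v) with (- (l * v)) in H by ring. rewrite sin_neg, cos_neg in H. nra.
  - rewrite Z; lra.
  - apply Rmult_le_pos; [lra|]. apply K; [lra|]. nra.
Qed.

(** The polar form of u + i v, with its argument expressed by atan: multiplication
    by e^(i v) adds v to the argument. *)
Lemma polar_upper (u v : R) : 0 < v ->
  exists r, 0 < r /\ r * r = u * u + v * v /\
    0 < PI / 2 - atan (u / v) < PI /\
    u * cos v - v * sin v = r * cos (v + (PI / 2 - atan (u / v))) /\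
    u * sin v + v * cos v = r * sin (v + (PI / 2 - atan (u / v))).
Proof.
  intros Hv. assert (B := atan_bound (u / v)).
  set (T := u / v). assert (Eu : u = T * v) by (unfold T; field; lra).
  assert (PT : 0 < 1 + Rsqr T) by (assert (A := Rle_0_sqr T); lra).
  assert (P : 0 < sqrt (1 + Rsqr T)) by (apply sqrt_lt_R0, PT).
  assert (ES : sqrt (1 + Rsqr T) * sqrt (1 + Rsqr T) = 1 + Rsqr T) by (apply sqrt_sqrt; lra).
  exists (v * sqrt (1 + Rsqr T)).
  split; [apply Rmult_lt_0_compat; assumption|]. split.
  { replace (v * sqrt (1 + Rsqr T) * (v * sqrt (1 + Rsqr T))) with
      (v * v * (sqrt (1 + Rsqr T) * sqrt (1 + Rsqr T))) by ring.
    rewrite ES, Eu. unfold Rsqr. ring. }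
  split; [fold T in B; lra|].
  rewrite cos_plus, sin_plus, cos_shift, sin_shift, cos_atan, sin_atan.
  split; rewrite Eu; field; lra.
Qed.

(** Equal values of x e^x have equal moduli and, because x lies in the strip and
    the value in the upper half plane, equal arguments Im x + arg x in (0, PI). So
    x + Log x takes the same value at both points. But the derivative 1 + 1/x of
    x + Log x has negative imaginary part on the upper half plane, which is
    convex, and this forces injectivity. *)
Lemma mul_exp_inj_upper (x y : C) :
  0 < Im x < PI -> 0 < Im y < PI -> (x * Cexp x = y * Cexp y)%C ->
  0 < Im (x * Cexp x)%C -> x = y.
Proof.
  intros Hx Hy E HI.
  destruct x as [u1 v1], y as [u2 v2]; simpl in Hx, Hy.
  assert (ER := f_equal Re E). assert (EI := f_equal Im E).
  rewrite !Re_mul_exp in ER. rewrite !Im_mul_exp in EI. rewrite Im_mul_exp in HI.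
  assert (HI2 := HI). rewrite EI in HI2. simpl in ER, EI, HI, HI2. clear E.
  destruct (polar_upper u1 v1 ltac:(lra)) as (r1 & P1 & Q1 & A1 & C1 & S1).
  destruct (polar_upper u2 v2 ltac:(lra)) as (r2 & P2 & Q2 & A2 & C2 & S2).
  rewrite C1, C2 in ER. rewrite S1, S2 in EI. rewrite S1 in HI. rewrite S2 in HI2.
  clear C1 C2 S1 S2.
  set (t1 := v1 + (PI / 2 - atan (u1 / v1))) in *. set (t2 := v2 + (PI / 2 - atan (u2 / v2))) in *.
  assert (X1 := exp_pos u1). assert (X2 := exp_pos u2).
  assert (M1 : 0 < exp u1 * r1) by (apply Rmult_lt_0_compat; assumption).
  assert (M2 : 0 < exp u2 * r2) by (apply Rmult_lt_0_compat; assumption).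
  assert (K : forall t m, 0 < m -> 0 < t < 2 * PI -> 0 < m * sin t -> 0 < t < PI).
  { intros t m Hm Ht Hs. split; [lra|]. apply Rnot_le_lt. intros H.
    assert (sin t <= 0) by (apply sin_le_0; lra). nra. }
  assert (T1 : 0 < t1 < PI) by (apply (K t1 (exp u1 * r1) M1); [unfold t1; lra | lra]).
  assert (T2 : 0 < t2 < PI) by (apply (K t2 (exp u2 * r2) M2); [unfold t2; lra | lra]).
  (* the moduli agree, hence so do the arguments *)
  assert (EM : exp u1 * r1 = exp u2 * r2).
  { assert (F1 := sin2_cos2 t1). assert (F2 := sin2_cos2 t2). unfold Rsqr in F1, F2.
    assert (W1 : exp u1 * r1 * (exp u1 * r1) =
      (exp u1 * (r1 * cos t1)) * (exp u1 * (r1 * cos t1)) +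
      (exp u1 * (r1 * sin t1)) * (exp u1 * (r1 * sin t1))).
    { transitivity (exp u1 * r1 * (exp u1 * r1) * (sin t1 * sin t1 + cos t1 * cos t1));
      [rewrite F1|]; ring. }
    assert (W2 : exp u2 * r2 * (exp u2 * r2) =
      (exp u2 * (r2 * cos t2)) * (exp u2 * (r2 * cos t2)) +
      (exp u2 * (r2 * sin t2)) * (exp u2 * (r2 * sin t2))).
    { transitivity (exp u2 * r2 * (exp u2 * r2) * (sin t2 * sin t2 + cos t2 * cos t2));
      [rewrite F2|]; ring. }
    rewrite ER, EI, <- W2 in W1. nra. }
  assert (ET : t1 = t2).
  { assert (cos t1 = cos t2).
    { apply (Rmult_eq_reg_l (exp u1 * r1)); [|lra]. rewrite EM at 2. lra. }
    rewrite <- (acos_cos t1), <- (acos_cos t2) by lra. now f_equal. }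
  assert (EL : u1 + ln (u1 * u1 + v1 * v1) / 2 = u2 + ln (u2 * u2 + v2 * v2) / 2).
  { rewrite <- Q1, <- Q2, !ln_mult by assumption.
    apply (f_equal ln) in EM. rewrite !ln_mult, !ln_exp in EM by assumption. lra. }
  destruct (classic (u1 = u2 /\ v1 = v2)) as [[-> ->]|N]; [reflexivity|exfalso].
  set (p := u2 - u1). set (q := v2 - v1).
  assert (PQ : 0 < p * p + q * q).
  { assert (Ap := Rle_0_sqr p). assert (Aq := Rle_0_sqr q).
    destruct (Req_dec p 0) as [Zp|Np]; [|apply Rsqr_pos_lt in Np; unfold Rsqr in *; lra].
    destruct (Req_dec q 0) as [Zq|Nq]; [|apply Rsqr_pos_lt in Nq; unfold Rsqr in *; lra].
    exfalso. apply N. unfold p, q in *. lra. }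
  (* the imaginary part of conj(d) (L + Log L), with d = p + i q the direction of the
     segment and L its point of parameter t *)
  set (phi := fun t => - q * (u1 + t * p + ln ((u1 + t * p) * (u1 + t * p) + (v1 + t * q) * (v1 + t * q)) / 2)
                + p * ((v1 + t * q) + (PI / 2 - atan ((u1 + t * p) / (v1 + t * q))))).
  assert (HV : forall t, 0 <= t <= 1 -> 0 < v1 + t * q).
  { intros t Ht. unfold q. replace (v1 + t * (v2 - v1)) with ((1 - t) * v1 + t * v2) by ring. nra. }
  assert (D : forall t, 0 <= t <= 1 -> is_derive phi t
     (- (p * p + q * q) * (v1 + t * q) / ((u1 + t * p) * (u1 + t * p) + (v1 + t * q) * (v1 + t * q)))).
  { intros t Ht. specialize (HV t Ht). unfold phi.
    assert (N2 : 0 < (u1 + t * p) * (u1 + t * p) + (v1 + t * q) * (v1 + t * q))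
      by (apply Rplus_le_lt_0_compat; [apply Rle_0_sqr | apply Rmult_lt_0_compat; assumption]).
    auto_derive.
    - repeat split; lra.
    - unfold Rsqr; field; repeat split; lra. }
  destruct (MVT_gen phi 0 1 (fun t =>
     - (p * p + q * q) * (v1 + t * q) / ((u1 + t * p) * (u1 + t * p) + (v1 + t * q) * (v1 + t * q))))
    as (t & Ht & Et); rewrite ?Rmin_left, ?Rmax_right in * by lra.
  - intros t Ht. apply D. lra.
  - intros t Ht. apply derivable_continuous_pt. eexists. apply is_derive_Reals, D, Ht.
  - assert (E0 : phi 1 - phi 0 = 0).
    { unfold phi, p, q.
      replace (u1 + 1 * (u2 - u1)) with u2 by ring. replace (v1 + 1 * (v2 - v1)) with v2 by ring.
      replace (u1 + 0 * (u2 - u1)) with u1 by ring. replace (v1 + 0 * (v2 - v1)) with v1 by ring.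
      fold t1. fold t2. rewrite ET, EL. ring. }
    specialize (HV t Ht).
    assert (N2 : 0 < (u1 + t * p) * (u1 + t * p) + (v1 + t * q) * (v1 + t * q))
      by (apply Rplus_le_lt_0_compat; [apply Rle_0_sqr | apply Rmult_lt_0_compat; assumption]).
    assert (0 < (p * p + q * q) * (v1 + t * q) / ((u1 + t * p) * (u1 + t * p) + (v1 + t * q) * (v1 + t * q))).
    { apply Rdiv_lt_0_compat; [apply Rmult_lt_0_compat; lra | exact N2]. }
    rewrite E0 in Et.
    replace (- (p * p + q * q) * (v1 + t * q) / ((u1 + t * p) * (u1 + t * p) + (v1 + t * q) * (v1 + t * q)) * (1 - 0))
      with (- ((p * p + q * q) * (v1 + t * q) / ((u1 + t * p) * (u1 + t * p) + (v1 + t * q) * (v1 + t * q)))) in Et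
      by (field; lra). lra.
Qed.

Lemma Cexp_conj (x : C) : Cexp (Cconj x) = Cconj (Cexp x).
Proof.
  destruct x as [u v]; unfold Cexp, Cconj; simpl. rewrite cos_neg, sin_neg.
  apply injective_projections; simpl; ring.
Qed.

Lemma mul_exp_conj (x : C) : (Cconj x * Cexp (Cconj x))%C = Cconj (x * Cexp x)%C.
Proof. rewrite Cexp_conj. symmetry. apply Cmult_conj. Qed.

(** If x = u + i v with v <> 0 and the value is real, then u = - v cot v and
    the value is - (v / sin v) e^u, which is negative. *)
Lemma positive_value_real (x : C) :
  - PI < Im x < PI -> Im (x * Cexp x)%C = 0 -> 0 < Re (x * Cexp x)%C -> Im x = 0 /\ 0 < Re x.
Proof.
  destruct x as [u v]. rewrite Re_mul_exp, Im_mul_exp. simpl. intros Hv HI HR.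
  assert (X := exp_pos u).
  assert (I0 : u * sin v + v * cos v = 0) by nra.
  assert (R0 : 0 < u * cos v - v * sin v) by nra.
  assert (V : v = 0).
  { destruct (Rtotal_order v 0) as [N|[Z|P]]; [exfalso| exact Z |exfalso].
    - assert (S : 0 < sin (- v)) by (apply sin_gt_0; lra). rewrite sin_neg in S.
      assert (F := sin2_cos2 v). unfold Rsqr in F.
      assert (sin v * (u * cos v - v * sin v) = - v).
      { replace (sin v * (u * cos v - v * sin v)) with
          ((u * sin v + v * cos v) * cos v - v * (sin v * sin v + cos v * cos v)) by ring.
        rewrite I0, F. ring. }
      nra.
    - assert (S : 0 < sin v) by (apply sin_gt_0; lra).
      assert (F := sin2_cos2 v). unfold Rsqr in F.
      assert (sin v * (u * cos v - v * sin v) = - v).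
      { replace (sin v * (u * cos v - v * sin v)) with
          ((u * sin v + v * cos v) * cos v - v * (sin v * sin v + cos v * cos v)) by ring.
        rewrite I0, F. ring. }
      nra. }
  split; [exact V|]. rewrite V, sin_0, cos_0 in R0. lra.
Qed.

Lemma region_upper (x : C) : region x -> 0 < Im (x * Cexp x)%C -> 0 < Im x < PI.
Proof.
  destruct x as [u v]. rewrite Im_mul_exp. unfold region; simpl. intros [H1 H2] H3.
  assert (X := exp_pos u). split; [|lra].
  assert (0 < u * sin v + v * cos v) by nra.
  destruct (Rtotal_order v 0) as [N|[Z|P]]; [nra | exfalso | exact P].
  rewrite Z, sin_0, cos_0 in H. lra.
Qed.

(** Conjugation exchanges the two half planes, and on the real axis x e^x
    increases where it is positive. *)
Lemma mul_exp_inj (x y : C) : region x -> region y ->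
  (x * Cexp x = y * Cexp y)%C -> slit_plane 0 (x * Cexp x)%C -> x = y.
Proof.
  intros Hx Hy E HS.
  destruct (Rtotal_order (Im (x * Cexp x)%C) 0) as [N|[Z|P]].
  - assert (E2 : (Cconj x * Cexp (Cconj x) = Cconj y * Cexp (Cconj y))%C)
      by (rewrite !mul_exp_conj; now f_equal).
    assert (P2 : 0 < Im (Cconj x * Cexp (Cconj x))%C).
    { rewrite mul_exp_conj. destruct (x * Cexp x)%C; simpl in *. lra. }
    assert (H : Cconj x = Cconj y).
    { apply mul_exp_inj_upper; try assumption; apply region_upper; try apply region_conj; try assumption.
      now rewrite <- E2. }
    apply (f_equal Cconj) in H. now rewrite !Cconj_conj in H.
  - assert (R0 : 0 < Re (x * Cexp x)%C).
    { apply Rnot_le_lt. intros H. apply HS. now split. }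
    destruct (positive_value_real x (proj1 Hx) Z R0) as [X1 X2].
    destruct (positive_value_real y (proj1 Hy)) as [Y1 Y2]; [now rewrite <- E | now rewrite <- E |].
    assert (ER := f_equal Re E). rewrite !Re_mul_exp, X1, Y1, sin_0, cos_0 in ER.
    apply injective_projections; [|change (Im x = Im y); lra]. change (Re x = Re y).
    destruct (Rtotal_order (Re x) (Re y)) as [L|[L|L]]; [exfalso| exact L |exfalso].
    + assert (X := exp_increasing _ _ L). assert (P1 := exp_pos (Re x)). nra.
    + assert (X := exp_increasing _ _ L). assert (P1 := exp_pos (Re y)). nra.
  - apply mul_exp_inj_upper; try assumption; apply region_upper; try assumption. now rewrite <- E.
Qed.

(** * Localization of the principal branch *)

(** As long as x e^x has positive imaginary part for x = u + i v on the path,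
    u sin v + v cos v > 0, which excludes v = 0 and v = PI. For x near 0 this
    expression has the sign of v, so the path leaves 0 upwards. *)
Lemma path_upper (om : R -> C) (z : C) :
  (forall t, 0 <= t <= 1 -> cont_C om t) -> om 0 = 0%C ->
  (forall t, 0 <= t <= 1 -> (om t * Cexp (om t))%C = (RtoC t * z)%C) ->
  0 < Im z -> region (om 1).
Proof.
  intros Hc H0 Hz HI.
  assert (Hp : forall t, 0 < t <= 1 ->
     0 < Re (om t) * sin (Im (om t)) + Im (om t) * cos (Im (om t))).
  { intros t Ht. assert (E := f_equal Im (Hz t ltac:(lra))). rewrite Im_mul_exp in E.
    replace (Im (RtoC t * z)%C) with (t * Im z) in E by (destruct z; simpl; ring).
    assert (P := exp_pos (Re (om t))). assert (0 < t * Im z) by nra.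
    apply (Rmult_lt_reg_l (exp (Re (om t)))); [exact P | lra]. }
  assert (Hcv : forall t, 0 <= t <= 1 -> continuity_pt (fun t => Im (om t)) t).
  { intros t Ht. apply continuity_pt_filterlim. apply (Hc t Ht). }
  assert (PP := PI_RGT_0).
  assert (B : Im (om 1) < PI).
  { assert (K : forall t, 0 < t <= 1 -> Im (om t) <> PI).
    { intros t Ht E. specialize (Hp t Ht). rewrite E, sin_PI, cos_PI in Hp. lra. }
    destruct (Rtotal_order (Im (om 1)) PI) as [L|[L|L]]; [exact L | | exfalso].
    - exfalso. apply (K 1); [lra | exact L].
    - destruct (Ranalysis5.IVT_interv (fun t => Im (om t) - PI) 0 1) as (t & Ht & Et).
      + intros t Ht. apply continuity_pt_minus; [apply Hcv, Ht | apply continuity_pt_const; intros ? ?; reflexivity].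
      + lra.
      + rewrite H0. simpl. lra.
      + lra.
      + destruct (Req_dec t 0) as [Z|Z]; [rewrite Z, H0 in Et; simpl in Et; lra|].
        apply (K t); lra. }
  assert (N : forall t, 0 < t <= 1 -> Im (om t) <> 0).
  { intros t Ht E. specialize (Hp t Ht). rewrite E, sin_0, cos_0 in Hp. lra. }
  assert (A : 0 < Im (om 1)).
  { destruct (Rtotal_order 0 (Im (om 1))) as [L|[L|L]]; [exact L | |exfalso].
    - exfalso. apply (N 1); [lra | now symmetry].
    - destruct (Hc 0 ltac:(lra)) as [C1 C2].
      assert (Hq : 0 < 1 / 4) by lra.
      assert (L1 : locally 0 (fun t => Rabs (Re (om t)) < 1 / 4 /\ Rabs (Im (om t)) < 1 / 4)).
      { apply filter_and.
        - generalize (proj1 (filterlim_locally _ _) C1 (mkposreal _ Hq)). apply filter_imp.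
          intros t Ht. rewrite H0 in Ht. change (Rabs (Re (om t) - 0) < 1 / 4) in Ht.
          now rewrite Rminus_0_r in Ht.
        - generalize (proj1 (filterlim_locally _ _) C2 (mkposreal _ Hq)). apply filter_imp.
          intros t Ht. rewrite H0 in Ht. change (Rabs (Im (om t) - 0) < 1 / 4) in Ht.
          now rewrite Rminus_0_r in Ht. }
      destruct L1 as [d Hd].
      set (t0 := Rmin (d / 2) (1 / 2)).
      assert (Pd := cond_pos d).
      assert (T0 : 0 < t0) by (apply Rmin_pos; lra).
      assert (T1 : t0 <= d / 2) by apply Rmin_l. assert (T2 : t0 <= 1 / 2) by apply Rmin_r.
      destruct (Hd t0) as [U V].
      { change (Rabs (t0 - 0) < d). rewrite Rminus_0_r, Rabs_pos_eq; lra. }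
      specialize (Hp t0 ltac:(lra)).
      destruct (Rtotal_order 0 (Im (om t0))) as [M|[M|M]].
      + destruct (Ranalysis5.IVT_interv (fun t => - Im (om t)) t0 1) as (t & Ht & Et); try lra.
        * intros t Ht. apply continuity_pt_opp, Hcv. lra.
        * apply (N t); lra.
      + apply (N t0); [lra | now symmetry].
      + assert (Q1 := one_minus_cos (Im (om t0))). assert (Q2 := abs_sin_le (Im (om t0))).
        set (v := Im (om t0)) in *. set (u := Re (om t0)) in *.
        rewrite (Rabs_left v) in Q2, V by lra.
        assert (Q3 : 1 / 2 <= cos v) by (apply Rabs_le_between in Q1; nra).
        assert (Q4 : u * sin v <= 1 / 4 * (- v)).
        { eapply Rle_trans; [apply Rle_abs|]. rewrite Rabs_mult.
          apply Rmult_le_compat; try apply Rabs_pos; lra. }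
        nra. }
  split; [lra|]. specialize (Hp 1 ltac:(lra)). nra.
Qed.

(** For z > 0 a path that left the real axis would, before leaving the strip, be at
    a nonreal point with a positive value of x e^x. *)
Lemma path_in_region (om : R -> C) (z : C) :
  (forall t, 0 <= t <= 1 -> cont_C om t) -> om 0 = 0%C ->
  (forall t, 0 <= t <= 1 -> (om t * Cexp (om t))%C = (RtoC t * z)%C) ->
  slit_plane 0 z -> region (om 1).
Proof.
  intros Hc H0 Hz HS.
  assert (PP := PI_RGT_0).
  destruct (Rtotal_order (Im z) 0) as [L|[L|L]].
  - rewrite <- (Cconj_conj (om 1)). apply region_conj.
    apply (path_upper (fun t => Cconj (om t)) (Cconj z)).
    + intros t Ht. destruct (Hc t Ht) as [A B]. split; simpl; [exact A|].
      apply (continuous_opp (fun t => Im (om t))), B.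
    + rewrite H0. apply injective_projections; simpl; ring.
    + intros t Ht. rewrite mul_exp_conj, (Hz t Ht), Cmult_conj. f_equal.
      apply injective_projections; simpl; ring.
    + destruct z; simpl in *; lra.
  - assert (R0 : 0 < Re z) by (apply Rnot_le_lt; intros H; apply HS; now split).
    assert (K : forall t, 0 < t <= 1 -> - PI < Im (om t) < PI -> Im (om t) = 0).
    { intros t Ht Hv. apply (positive_value_real (om t) Hv); rewrite (Hz t ltac:(lra)).
      - destruct z as [a b]; simpl in *. rewrite L; ring.
      - destruct z as [a b]; simpl in *. rewrite L. assert (0 < t * a) by nra. lra. }
    (* s is the side on which the path would leave the strip; on its way it would meet
       the ordinate s PI / 2 *)
    assert (K2 : forall s, (s = 1 \/ s = -1) -> ~ PI <= s * Im (om 1)).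
    { intros s Hs H.
      destruct (Ranalysis5.IVT_interv (fun t => s * Im (om t) - PI / 2) 0 1) as (t & Ht & Et).
      - intros t Ht. apply continuity_pt_filterlim.
        apply (continuous_minus (fun t => s * Im (om t)) (fun _ => PI / 2)); [|apply continuous_const].
        apply (continuous_mult (fun _ => s) (fun t => Im (om t))); [apply continuous_const | apply (Hc t Ht)].
      - lra.
      - rewrite H0. simpl. lra.
      - lra.
      - destruct (Req_dec t 0) as [Z|Z]; [rewrite Z, H0 in Et; simpl in Et; lra|].
        assert (E := K t ltac:(lra)). destruct Hs; subst s.
        + rewrite E in Et; lra.
        + rewrite E in Et; lra. }
    assert (E : Im (om 1) = 0).
    { apply K; [lra|]. split.
      - apply Rnot_le_lt. intros H. apply (K2 (-1)); [now right | lra].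
      - apply Rnot_le_lt. intros H. apply (K2 1); [now left | lra]. }
    unfold region. rewrite E, sin_0. lra.
  - apply (path_upper om z); assumption.
Qed.

Lemma slit_plane_segment (z : C) (t : R) :
  0 <= t <= 1 -> slit_plane 0 z -> slit_plane (- (1 / exp 1)) (RtoC t * z).
Proof.
  intros Ht HS [HI HR]. assert (P : 0 < 1 / exp 1) by (apply Rdiv_lt_0_compat; [lra | apply exp_pos]).
  destruct z as [a b]; simpl in *.
  apply HS; simpl. destruct (Req_dec t 0) as [Z|Z].
  - rewrite Z in HR. lra.
  - assert (t * b = 0) by lra.
    assert (b = 0) by (apply Rmult_integral in H as [H|H]; [contradiction | exact H]).
    split; [assumption|]. nra.
Qed.

(** The path t -> W(t z) starts at 0 and solves x e^x = t z. *)
Lemma lambert_in_region (W : C -> C) (z : C) :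
  is_principal_LambertW W -> slit_plane 0 z -> region (W z).
Proof.
  intros (H1 & H2 & H3) HS.
  replace (W z) with (W (RtoC 1 * z)%C) by (f_equal; ring).
  apply (path_in_region (fun t => W (RtoC t * z)%C) z).
  - intros t Ht. apply continuous_cont_C.
    apply (continuous_comp (U := R_UniformSpace) (V := AbsRing_UniformSpace C_AbsRing)
             (fun t : R => RtoC t * z)%C W).
    + apply filterlim_locally. intros eps.
      assert (Pz := Cmod_ge_0 z).
      assert (Pd : 0 < eps / (Cmod z + 1)) by (apply Rdiv_lt_0_compat; [apply eps | lra]).
      exists (mkposreal _ Pd). intros s Hs. change (Rabs (s - t) < eps / (Cmod z + 1)) in Hs.
      change (Cmod (RtoC s * z - RtoC t * z)%C < eps).
      replace (RtoC s * z - RtoC t * z)%C with (RtoC (s - t) * z)%C by (rewrite RtoC_minus; ring).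
      rewrite Cmod_mult, Cmod_R. assert (Q := Rabs_pos (s - t)).
      apply Rle_lt_trans with (Rabs (s - t) * (Cmod z + 1)); [nra|].
      apply (Rmult_lt_compat_r (Cmod z + 1)) in Hs; [|lra].
      replace (eps / (Cmod z + 1) * (Cmod z + 1)) with (pos eps) in Hs by (field; lra). exact Hs.
    + apply (ex_derive_continuous (K := C_AbsRing) (V := C_NormedModule)).
      apply H1, slit_plane_segment; assumption.
  - replace (RtoC 0 * z)%C with (RtoC 0) by ring. exact H3.
  - intros t Ht. apply H2, slit_plane_segment; assumption.
  - exact HS.
Qed.

(** * Holomorphic functions along the boundary curve *)

Definition hol (D : C -> Prop) (g : C -> C) : Prop := exists g', hol_with D g g'.

Lemma cont_C_id (x : C) : cont_C (fun y : C => y) x.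
Proof. apply continuous_cont_C, continuous_id. Qed.

Lemma hol_const (D : C -> Prop) (a : C) : hol D (fun _ => a).
Proof.
  exists (fun _ => RtoC 0). intros x _. split; [apply cont_C_const | split; [apply cont_C_const|]].
  intros c t l _ _. eapply deriv_C_val; [apply deriv_C_const | ring].
Qed.

Lemma hol_id (D : C -> Prop) : hol D (fun x => x).
Proof.
  exists (fun _ => RtoC 1). intros x _. split; [apply cont_C_id | split; [apply cont_C_const|]].
  intros c t l _ H. eapply deriv_C_val; [exact H | ring].
Qed.

Lemma hol_plus (D : C -> Prop) (f g : C -> C) :
  hol D f -> hol D g -> hol D (fun x => f x + g x)%C.
Proof.
  intros [f' Hf] [g' Hg]. exists (fun x => f' x + g' x)%C. intros x Dx.
  destruct (Hf x Dx) as (F1 & F2 & F3), (Hg x Dx) as (G1 & G2 & G3).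
  split; [|split]; try (apply cont_C_plus; assumption).
  intros c t l E H. eapply deriv_C_val.
  - apply (deriv_C_plus (fun s => f (c s)) (fun s => g (c s))); [apply F3 | apply G3]; eassumption.
  - ring.
Qed.

Lemma hol_mult (D : C -> Prop) (f g : C -> C) :
  hol D f -> hol D g -> hol D (fun x => f x * g x)%C.
Proof.
  intros [f' Hf] [g' Hg]. exists (fun x => f' x * g x + f x * g' x)%C. intros x Dx.
  destruct (Hf x Dx) as (F1 & F2 & F3), (Hg x Dx) as (G1 & G2 & G3).
  split; [apply cont_C_mult; assumption | split; [apply cont_C_plus; apply cont_C_mult; assumption |]].
  intros c t l E H. eapply deriv_C_val.
  - apply (deriv_C_mult (fun s => f (c s)) (fun s => g (c s))); [apply F3 | apply G3]; eassumption.
  - simpl. rewrite E. ring.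
Qed.

Lemma hol_minus (D : C -> Prop) (f g : C -> C) :
  hol D f -> hol D g -> hol D (fun x => f x - g x)%C.
Proof.
  intros [f' Hf] [g' Hg]. exists (fun x => f' x - g' x)%C. intros x Dx.
  destruct (Hf x Dx) as (F1 & F2 & F3), (Hg x Dx) as (G1 & G2 & G3).
  split; [|split]; try (apply cont_C_minus; assumption).
  intros c t l E H. eapply deriv_C_val.
  - apply (deriv_C_minus (fun s => f (c s)) (fun s => g (c s))); [apply F3 | apply G3]; eassumption.
  - ring.
Qed.

Lemma hol_inv (D : C -> Prop) (f : C -> C) :
  (forall x, D x -> f x <> 0%C) -> hol D f -> hol D (fun x => / f x)%C.
Proof.
  intros N [f' Hf]. exists (fun x => - f' x * / (f x * f x))%C. intros x Dx.
  destruct (Hf x Dx) as (F1 & F2 & F3). specialize (N x Dx).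
  split; [apply cont_C_inv; assumption | split].
  - apply cont_C_mult; [apply cont_C_opp; assumption|].
    apply cont_C_inv; [apply cont_C_mult; assumption | apply Cmult_neq_0; assumption].
  - intros c t l E H. eapply deriv_C_val.
    + apply (deriv_C_inv (fun s => f (c s))); [apply (F3 c t l); assumption | now rewrite E].
    + simpl. rewrite E. field. exact N.
Qed.

Lemma hol_exp_moment (D : C -> Prop) (j : nat) (a : C) : hol D (fun x => exp_moment j (a - x)).
Proof.
  exists (fun x => - exp_moment (S j) (a - x))%C. intros x _.
  assert (Ha : cont_C (fun y => a - y)%C x) by (apply cont_C_minus; [apply cont_C_const | apply cont_C_id]).
  split; [|split].
  - apply (cont_C_comp (fun y => a - y)%C); [exact Ha | apply exp_moment_cont].
  - apply cont_C_opp, (cont_C_comp (fun y => a - y)%C); [exact Ha | apply exp_moment_cont].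
  - intros c t l E H. eapply deriv_C_val.
    + apply (exp_moment_deriv j (fun s => a - c s)%C t (0 - l)%C).
      apply (deriv_C_minus (fun _ => a) c); [apply deriv_C_const | exact H].
    + rewrite E. ring.
Qed.

Lemma open_neq_0 (f : C -> C) : (forall x, cont_C f x) -> open (fun x => f x <> 0%C).
Proof.
  intros Hf x Hx. apply (cont_C_continuous _ _ (Hf x) (fun y => y <> RtoC 0)).
  refine (locally_Cmod (f x) (fun y => y <> RtoC 0) _). apply Cmod_gt_0 in Hx. exists (mkposreal _ Hx). simpl.
  intros h Hh E. apply (Rlt_irrefl (Cmod h)).
  replace (Cmod h) with (Cmod (f x)) at 2; [exact Hh|].
  replace (f x) with (- h)%C; [apply Cmod_opp|].
  replace (f x) with ((f x + h) - h)%C by ring. rewrite E. ring.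
Qed.

Definition vertical (v y : R) : C := (- (v * cot v), y).
Definition curve (v : R) : C := vertical v v.
Definition dcurve (v : R) : C := (- cot v + v / (sin v * sin v), 1).

Lemma curve_deriv (v : R) : 0 < v < PI -> deriv_C curve v (dcurve v).
Proof.
  intros Hv. assert (S : 0 < sin v) by (apply sin_gt_0; lra).
  assert (F := sin2_cos2 v). unfold Rsqr in F.
  split; unfold curve, vertical, dcurve, cot; simpl.
  - auto_derive; [lra|].
    replace (cos v * cos v) with (1 - sin v * sin v) by lra. 
    field_simplify_eq; [|lra].
    assert (E : cos v ^ 2 = 1 - sin v ^ 2) by (simpl; lra). rewrite ?E. ring.
  - apply @is_derive_id.
Qed.

Lemma continuous_of_ex_derive (f : R -> R) (v : R) : ex_derive f v -> continuous f v.
Proof. apply @ex_derive_continuous. Qed.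

Lemma dcurve_cont (v : R) : 0 < v < PI -> cont_C dcurve v.
Proof.
  intros Hv. assert (S : 0 < sin v) by (apply sin_gt_0; lra).
  split; unfold dcurve, cot; simpl; [|apply continuous_const].
  apply continuous_of_ex_derive. auto_derive. repeat split; try lra. nra.
Qed.

Lemma locally_0PI (v : R) (P : R -> Prop) :
  0 < v < PI -> (forall x, 0 < x < PI -> P x) -> locally v P.
Proof.
  intros Hv H.
  assert (Pd : 0 < Rmin v (PI - v)) by (apply Rmin_pos; lra).
  exists (mkposreal _ Pd). simpl. intros x Hx. change (Rabs (x - v) < Rmin v (PI - v)) in Hx.
  assert (A := Rmin_l v (PI - v)). assert (B := Rmin_r v (PI - v)).
  apply Rabs_lt_between in Hx. apply H. lra.
Qed.

(** y cot y decreases on (0, PI), so the chord from the boundary point to its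
    conjugate stays on the right of the curve. *)
Lemma region_vertical (v y : R) : 0 < v < PI -> - v <= y <= v -> region (vertical v y).
Proof.
  intros Hv Hy.
  assert (K : forall y, 0 < y <= v -> 0 <= - (v * cot v) * sin y + y * cos y).
  { clear y Hy. intros y Hy. assert (S : 0 < sin y) by (apply sin_gt_0; lra).
    assert (L : v * cot v <= y * cot y).
    { destruct (Req_dec y v) as [->|N]; [lra|].
      destruct (MVT_gen (fun x => Re (curve x)) y v (fun x => Re (dcurve x))) as (x & Hx & E);
      rewrite ?Rmin_left, ?Rmax_right in * by lra.
      - intros x Hx. apply curve_deriv. lra.
      - intros x Hx. apply continuity_pt_filterlim. apply (deriv_C_cont curve x (dcurve x)), curve_deriv. lra.
      - simpl in E. unfold cot at 3 in E. assert (Sx : 0 < sin x) by (apply sin_gt_0; lra).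
        assert (0 <= - (cos x / sin x) + x / (sin x * sin x)).
        { replace (- (cos x / sin x) + x / (sin x * sin x)) with ((x - sin x * cos x) / (sin x * sin x))
            by (field; lra).
          apply Rdiv_le_0_compat; [|nra].
          assert (B := COS_bound x). assert (A := sin_lt_x x ltac:(lra)). nra. }
        nra. }
    unfold cot at 2 in L.
    apply Rle_trans with ((y * (cos y / sin y) - v * cot v) * sin y);
    [apply Rmult_le_pos; lra | right; field; lra]. }
  unfold region; simpl. split; [lra|].
  destruct (Rtotal_order y 0) as [N|[Z|P]].
  - specialize (K (- y) ltac:(lra)). rewrite sin_neg, cos_neg in K. nra.
  - rewrite Z; lra.
  - specialize (K y ltac:(lra)). nra.
Qed.

(** The integral of g along the boundary curve between ordinates - v and v. Its
    derivative in v is read on the curve, its value on the vertical chord with the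
    same ends. *)
Definition prim_gap (g : C -> C) (v : R) : C := (prim g (curve v) - prim g (Cconj (curve v)))%C.

Lemma prim_gap_deriv (D : C -> Prop) (g : C -> C) (v : R) :
  open D -> hol D g -> (forall x, region x -> D x) -> 0 < v < PI ->
  deriv_C (prim_gap g) v (g (curve v) * dcurve v - g (Cconj (curve v)) * Cconj (dcurve v))%C.
Proof.
  intros HO [g' Hg] HD Hv.
  assert (Hz : region (curve v)) by (apply region_vertical; lra).
  apply (deriv_C_minus (fun v => prim g (curve v)) (fun v => prim g (Cconj (curve v)))).
  - apply (prim_deriv D g g' curve dcurve); try assumption.
    + apply locally_0PI; [exact Hv | apply curve_deriv].
    + apply dcurve_cont, Hv.
    + intros s Hs. apply HD, region_star; assumption.
  - apply (prim_deriv D g g' (fun v => Cconj (curve v)) (fun v => Cconj (dcurve v))); try assumption.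
    + apply locally_0PI; [exact Hv |]. intros x Hx. destruct (curve_deriv x Hx) as [A B].
      split; [exact A|]. apply (is_derive_opp (fun s => Im (curve s))), B.
    + destruct (dcurve_cont v Hv) as [A B]. split; [exact A|].
      apply (continuous_opp (fun s => Im (dcurve s))), B.
    + intros s Hs. apply HD, region_star; [assumption | apply region_conj, Hz].
Qed.

(** The mean value theorem along the vertical chord, for each component. *)
Lemma prim_gap_mean_value (D : C -> Prop) (g : C -> C) (v : R) :
  open D -> hol D g -> (forall x, region x -> D x) -> 0 < v < PI ->
  (exists y, Rabs y <= v /\ Re (prim_gap g v) = 2 * v * Re (g (vertical v y) * Ci)%C) /\
  (exists y, Rabs y <= v /\ Im (prim_gap g v) = 2 * v * Im (g (vertical v y) * Ci)%C).
Proof.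
  intros HO [g' Hg] HD Hv.
  set (c := vertical v).
  assert (H : forall y, - v <= y <= v -> deriv_C (fun y => prim g (c y)) y (g (c y) * Ci)%C).
  { intros y Hy.
    apply (prim_deriv D g g' c (fun _ => Ci)); try assumption.
    - apply filter_forall. intros x. split; simpl.
      + apply (is_derive_const (K := R_AbsRing) (V := R_NormedModule)).
      + apply @is_derive_id.
    - apply cont_C_const.
    - intros s Hs. apply HD, region_star; [exact Hs | apply region_vertical; assumption]. }
  assert (K : forall y, Rabs y <= v <-> - v <= y <= v) by (intros y; apply Rabs_le_between).
  assert (E : prim_gap g v = (prim g (c v) - prim g (c (- v)%R))%C) by reflexivity.
  split.
  - destruct (MVT_gen (fun y => Re (prim g (c y))) (- v) v (fun y => Re (g (c y) * Ci)%C)) as (y & Hy & Ey);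
    rewrite ?Rmin_left, ?Rmax_right in * by lra.
    + intros y Hy. apply H. lra.
    + intros y Hy. apply continuity_pt_filterlim. apply (deriv_C_cont _ _ _ (H y Hy)).
    + exists y. split; [apply K, Hy|]. rewrite E. fold c.
      change (Re (prim g (c v)) + - Re (prim g (c (- v)%R)) = 2 * v * Re (g (c y) * Ci)%C).
      unfold Rminus in Ey. rewrite Ey. ring.
  - destruct (MVT_gen (fun y => Im (prim g (c y))) (- v) v (fun y => Im (g (c y) * Ci)%C)) as (y & Hy & Ey);
    rewrite ?Rmin_left, ?Rmax_right in * by lra.
    + intros y Hy. apply H. lra.
    + intros y Hy. apply continuity_pt_filterlim. apply (deriv_C_cont _ _ _ (H y Hy)).
    + exists y. split; [apply K, Hy|]. rewrite E. fold c.
      change (Im (prim g (c v)) + - Im (prim g (c (- v)%R)) = 2 * v * Im (g (c y) * Ci)%C).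
      unfold Rminus in Ey. rewrite Ey. ring.
Qed.

(** * Limits at the two ends of the boundary curve *)

Definition lim_C (f : R -> C) (F : (R -> Prop) -> Prop) (l : C) : Prop :=
  filterlim (fun v => Re (f v)) F (locally (Re l)) /\
  filterlim (fun v => Im (f v)) F (locally (Im l)).

Lemma at_right_0 (P : R -> Prop) (d : R) :
  0 < d -> (forall v, 0 < v < d -> P v) -> at_right 0 P.
Proof.
  intros Hd H. exists (mkposreal _ Hd). intros v Hv Pv. apply H.
  change (Rabs (v - 0) < d) in Hv. rewrite Rminus_0_r, Rabs_pos_eq in Hv; lra.
Qed.

Lemma at_left_PI (P : R -> Prop) (d : R) :
  0 < d -> (forall v, PI - d < v < PI -> P v) -> at_left PI P.
Proof.
  intros Hd H. exists (mkposreal _ Hd). intros v Hv Pv. apply H.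
  change (Rabs (v - PI) < d) in Hv. apply Rabs_lt_between in Hv. lra.
Qed.

Lemma v_cot_v_near_0 (v : R) : 0 < v <= 1 / 2 -> Rabs (v * cot v - 1) <= 4 * v.
Proof.
  intros Hv. assert (S := sin_minus_id v ltac:(rewrite Rabs_pos_eq; lra)).
  assert (K := one_minus_cos v).
  apply Rabs_le_between in S. apply Rabs_le_between in K.
  assert (S2 : v / 2 <= sin v) by nra.
  unfold cot. replace (v * (cos v / sin v) - 1) with ((v * cos v - sin v) / sin v) by (field; lra).
  assert (A : Rabs (v * cos v - sin v) <= 2 * (v * v)) by (apply Rabs_le; nra).
  unfold Rdiv. rewrite Rabs_mult, (Rabs_pos_eq (/ sin v)) by (apply Rlt_le, Rinv_0_lt_compat; lra).
  apply (Rmult_le_reg_r (sin v)); [lra|].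
  rewrite Rmult_assoc, Rinv_l, Rmult_1_r by lra. nra.
Qed.

Lemma v_cot_v_near_PI (v : R) : 0 < PI - v <= 1 -> 1 / (PI - v) <= - (v * cot v).
Proof.
  intros Hv. assert (P3 := PI2_3_2).
  set (x := PI - v) in *. assert (Ev : v = PI - x) by (unfold x; ring).
  assert (K := one_minus_cos x). apply Rabs_le_between in K.
  assert (Sx : 0 < sin x) by (apply sin_gt_0; lra).
  assert (S2 : sin x < x) by (apply sin_lt_x; lra).
  assert (Es : sin v = sin x) by (rewrite Ev, sin_minus, sin_PI, cos_PI; ring).
  assert (Ec : cos v = - cos x) by (rewrite Ev, cos_minus, sin_PI, cos_PI; ring).
  unfold cot. rewrite Es, Ec.
  replace (- (v * (- cos x / sin x))) with (v * cos x * (1 / sin x)) by (field; lra).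
  assert (I1 : 1 / x <= 1 / sin x).
  { unfold Rdiv. rewrite !Rmult_1_l. apply Rinv_le_contravar; lra. }
  assert (I2 : 0 < 1 / x) by (apply Rdiv_lt_0_compat; lra).
  assert (X2 : x * x <= 1 * 1) by (apply Rmult_le_compat; lra).
  assert (V : 2 * (1 / 2) <= v * cos x) by (apply Rmult_le_compat; lra).
  assert (T : 1 * (1 / x) <= v * cos x * (1 / sin x)) by (apply Rmult_le_compat; lra). lra.
Qed.

(** The chord shrinks to the point -1, near which g is bounded. *)
Lemma prim_gap_lim_0 (D : C -> Prop) (g : C -> C) :
  open D -> hol D g -> (forall x, region x -> D x) -> lim_C (prim_gap g) (at_right 0) 0.
Proof.
  intros HO Hg HD. assert (PP := PI_RGT_0).
  assert (Om1 : region (-1, 0)) by (unfold region; simpl; rewrite sin_0; lra).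
  assert (B : exists d : posreal, forall h, Cmod h < d -> Cmod (g ((-1, 0) + h) * Ci)%C <= Cmod (g (-1, 0)) + 1).
  { destruct Hg as [g' Hg]. destruct (Hg _ (HD _ Om1)) as ([C1 C2] & _).
    assert (Hq : 0 < 1 / 2) by lra.
    assert (L1 := proj1 (filterlim_locally _ _) C1 (mkposreal _ Hq)).
    assert (L2 := proj1 (filterlim_locally _ _) C2 (mkposreal _ Hq)).
    destruct (locally_Cmod_inv _ _ (filter_and _ _ L1 L2)) as [d Hd].
    exists d. intros h Hh. destruct (Hd h Hh) as [A1 A2].
    change (Rabs (Re (g ((-1, 0) + h)%C) - Re (g (-1, 0))) < 1 / 2) in A1.
    change (Rabs (Im (g ((-1, 0) + h)%C) - Im (g (-1, 0))) < 1 / 2) in A2.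
    rewrite Cmod_mult, Cmod_Ci, Rmult_1_r.
    replace (g ((-1, 0) + h)%C) with (g (-1, 0) + (g ((-1, 0) + h) - g (-1, 0)))%C by ring.
    eapply Rle_trans; [apply Cmod_triangle|]. apply Rplus_le_compat_l.
    eapply Rle_trans; [apply Cmod_le_Re_Im|].
    unfold Rminus in A1, A2. simpl. unfold Re, Im in *. lra. }
  destruct B as [d B]. set (M := Cmod (g (-1, 0)) + 1) in *.
  assert (HM : 1 <= M) by (unfold M; assert (P := Cmod_ge_0 (g (-1, 0))); lra).
  assert (Pd := cond_pos d).
  (* 1 - v cot v is at most 4 v and y at most v, so the chord is within 5 v of -1 *)
  assert (K : forall v y, 0 < v < Rmin (d / 5) (1 / 2) -> Rabs y <= v ->
     Cmod (g (vertical v y) * Ci)%C <= M).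
  { intros v y Hv Hy. assert (A1 := Rmin_l (d / 5) (1 / 2)). assert (A2 := Rmin_r (d / 5) (1 / 2)).
    replace (vertical v y) with (Cplus (-1, 0) (1 - v * cot v, y))
      by (unfold vertical; apply injective_projections; simpl; ring).
    apply B. eapply Rle_lt_trans; [apply Cmod_le_Re_Im|]. simpl.
    assert (A := v_cot_v_near_0 v ltac:(lra)). rewrite Rabs_minus_sym in A. unfold Rminus in *. lra. }
  assert (Lim : forall h : R -> R, (forall v, 0 < v < Rmin (d / 5) (1 / 2) -> Rabs (h v) <= 2 * v * M) ->
     filterlim h (at_right 0) (locally 0)).
  { intros h Hh. apply filterlim_locally. intros eps.
    assert (Pe := cond_pos eps).
    apply (at_right_0 _ (Rmin (Rmin (d / 5) (1 / 2)) (eps / (2 * M)))).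
    - repeat apply Rmin_pos; try lra. apply Rdiv_lt_0_compat; lra.
    - intros v Hv. assert (A1 := Rmin_l (Rmin (d / 5) (1 / 2)) (eps / (2 * M))).
      assert (A2 := Rmin_r (Rmin (d / 5) (1 / 2)) (eps / (2 * M))).
      change (Rabs (h v - 0) < eps). rewrite Rminus_0_r.
      eapply Rle_lt_trans; [apply Hh; lra|].
      replace (pos eps) with (eps / (2 * M) * (2 * M)) by (field; lra).
      replace (2 * v * M) with (v * (2 * M)) by ring. apply Rmult_lt_compat_r; lra. }
  assert (Hmean := fun v Hv => prim_gap_mean_value D g v HO Hg HD Hv).
  assert (P3 := PI2_3_2).
  split; apply Lim; intros v Hv; assert (A2 := Rmin_r (d / 5) (1 / 2));
  destruct (Hmean v ltac:(lra)) as [(y1 & Hy1 & E1) (y2 & Hy2 & E2)].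
  - rewrite E1, Rabs_mult, (Rabs_pos_eq (2 * v)) by lra.
    apply Rmult_le_compat_l; [lra|]. eapply Rle_trans; [apply re_le_Cmod | apply K; assumption].
  - rewrite E2, Rabs_mult, (Rabs_pos_eq (2 * v)) by lra.
    apply Rmult_le_compat_l; [lra|]. eapply Rle_trans; [apply Im_le_Cmod | apply K; assumption].
Qed.

Definition lim_right (g : C -> C) (L : C) : Prop :=
  forall eps, 0 < eps -> exists M, forall x, M <= Re x -> Rabs (Im x) <= PI -> Cmod (g x - L)%C < eps.

(** The chord runs off to the right, where g is close to L, and its length tends
    to 2 PI. *)
Lemma prim_gap_lim_PI (D : C -> Prop) (g : C -> C) (L : C) :
  open D -> hol D g -> (forall x, region x -> D x) -> lim_right g L ->
  lim_C (prim_gap g) (at_left PI) (2 * PI * (L * Ci))%C.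
Proof.
  intros HO Hg HD HT. assert (P3 := PI2_3_2).
  assert (Hmean := fun v Hv => prim_gap_mean_value D g v HO Hg HD Hv).
  assert (K : forall eps, 0 < eps -> exists d, 0 < d <= 1 /\ forall v y, PI - d < v < PI -> Rabs y <= v ->
     Cmod (g (vertical v y) * Ci - L * Ci)%C < eps).
  { intros eps Heps. destruct (HT eps Heps) as [M HM].
    (* near PI the abscissa - v cot v is at least 1 / (PI - v), hence larger than M *)
    set (d := 1 / (Rabs M + 1)).
    assert (PM := Rabs_pos M).
    assert (Pd : 0 < d) by (apply Rdiv_lt_0_compat; lra).
    assert (Ed : d * (Rabs M + 1) = 1) by (unfold d; field; lra).
    exists d. split; [nra|]. intros v y Hv Hy.
    replace (g (vertical v y) * Ci - L * Ci)%C with ((g (vertical v y) - L) * Ci)%C by ring.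
    rewrite Cmod_mult, Cmod_Ci, Rmult_1_r. apply HM; simpl; [|lra].
    apply Rle_trans with (1 / (PI - v)); [|apply v_cot_v_near_PI; nra].
    apply Rle_trans with (Rabs M + 1); [assert (A := Rle_abs M); lra|].
    apply (Rmult_le_reg_r (PI - v)); [lra|].
    replace (1 / (PI - v) * (PI - v)) with 1 by (field; lra). nra. }
  assert (Lim : forall (h : R -> R) (l : R) (c : R -> R -> R),
     (forall v, 0 < v < PI -> exists y, Rabs y <= v /\ h v = 2 * v * c v y) ->
     (forall v y, Rabs (c v y - l) <= Cmod (g (vertical v y) * Ci - L * Ci)%C) ->
     filterlim h (at_left PI) (locally (2 * PI * l))).
  { intros h l c Hh Hc. apply filterlim_locally. intros eps.
    assert (Pe := cond_pos eps).
    assert (Pl := Rabs_pos l).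
    assert (Pe2 : 0 < eps / (4 * PI)) by (apply Rdiv_lt_0_compat; lra).
    destruct (K _ Pe2) as (d & Hd & Kd).
    assert (Pe3 : 0 < eps / (4 * (Rabs l + 1))) by (apply Rdiv_lt_0_compat; lra).
    apply (at_left_PI _ (Rmin d (eps / (4 * (Rabs l + 1))))); [apply Rmin_pos; lra|].
    intros v Hv.
    assert (A1 := Rmin_l d (eps / (4 * (Rabs l + 1)))). assert (A2 := Rmin_r d (eps / (4 * (Rabs l + 1)))).
    destruct (Hh v ltac:(lra)) as (y & Hy & E).
    change (Rabs (h v - 2 * PI * l) < eps). rewrite E.
    replace (2 * v * c v y - 2 * PI * l) with (2 * v * (c v y - l) + - (2 * (PI - v) * l)) by ring.
    eapply Rle_lt_trans; [apply Rabs_triang|].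
    rewrite Rabs_Ropp, !Rabs_mult, (Rabs_pos_eq 2), (Rabs_pos_eq v), (Rabs_pos_eq (PI - v)) by lra.
    assert (B1 : Rabs (c v y - l) < eps / (4 * PI)).
    { eapply Rle_lt_trans; [apply Hc | apply Kd; [lra | exact Hy]]. }
    assert (B2 : 2 * v * Rabs (c v y - l) <= 2 * PI * (eps / (4 * PI))).
    { apply Rmult_le_compat; try lra. apply Rabs_pos. }
    assert (B3 : 2 * (PI - v) * Rabs l <= 2 * (eps / (4 * (Rabs l + 1))) * Rabs l).
    { apply Rmult_le_compat_r; lra. }
    assert (B4 : 2 * (eps / (4 * (Rabs l + 1))) * Rabs l < 2 * (eps / (4 * (Rabs l + 1))) * (Rabs l + 1)) by nra.
    replace (2 * (eps / (4 * (Rabs l + 1))) * (Rabs l + 1)) with (eps / 2) in B4 by (field; lra).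
    replace (2 * PI * (eps / (4 * PI))) with (eps / 2) in B2 by (field; lra).
    lra. }
  split.
  - replace (Re (2 * PI * (L * Ci))%C) with (2 * PI * Re (L * Ci)%C) by (destruct L; simpl; ring).
    apply (Lim _ _ (fun v y => Re (g (vertical v y) * Ci)%C)).
    + intros v Hv. apply Hmean, Hv.
    + intros v y. assert (A := re_le_Cmod (g (vertical v y) * Ci - L * Ci)%C). exact A.
  - replace (Im (2 * PI * (L * Ci))%C) with (2 * PI * Im (L * Ci)%C) by (destruct L; simpl; ring).
    apply (Lim _ _ (fun v y => Im (g (vertical v y) * Ci)%C)).
    + intros v Hv. apply Hmean, Hv.
    + intros v y. assert (A := Im_le_Cmod (g (vertical v y) * Ci - L * Ci)%C). exact A.
Qed.

(** The continuous extensions of f and P to [0, PI] satisfy the fundamental theorem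
    of calculus, and f differs from its extension at the endpoints at most. *)
Lemma RInt_of_primitive (f P : R -> R) (a b fa fb : R) :
  (forall v, 0 < v < PI -> is_derive P v (f v)) ->
  (forall v, 0 < v < PI -> continuous f v) ->
  filterlim f (at_right 0) (locally fa) -> filterlim f (at_left PI) (locally fb) ->
  filterlim P (at_right 0) (locally a) -> filterlim P (at_left PI) (locally b) ->
  is_RInt f 0 PI (b - a).
Proof.
  intros HP Hf Hfa Hfb Ha Hb. assert (PP := PI_RGT_0).
  destruct (C0_extension_lt f fa fb 0 PI PP Hf Hfa Hfb) as (g & Cg & Eg & _).
  destruct (C0_extension_lt P a b 0 PI PP) as (Q & CQ & EQ & Qa & Qb); try assumption.
  { intros v Hv. apply (ex_derive_continuous P v). eexists. apply HP, Hv. }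
  apply (is_RInt_ext g).
  { rewrite Rmin_left, Rmax_right by lra. exact Eg. }
  set (G := fun v => RInt g 0 v).
  assert (HG : forall v, is_derive G v (g v)).
  { intros v. apply (is_derive_RInt g G 0 v); [|apply Cg].
    apply filter_forall. intros x.
    apply (RInt_correct (V := R_CompleteNormedModule)).
    apply (ex_RInt_continuous (V := R_CompleteNormedModule)). intros; apply Cg. }
  assert (HGP : G PI = b - a).
  { destruct (MVT_gen (fun v => G v - Q v) 0 PI (fun _ => 0)) as (x & _ & E).
    - rewrite Rmin_left, Rmax_right by lra. intros v Hv.
      apply (is_derive_val _ _ (g v - f v)); [|rewrite (Eg v Hv); ring].
      apply (is_derive_minus G Q); [apply HG|].
      apply (is_derive_ext_loc P); [|apply HP, Hv].
      apply locally_0PI; [exact Hv|]. intros x Hx. symmetry. apply EQ, Hx.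
    - intros v _. apply continuity_pt_minus; apply continuity_pt_filterlim; [|apply CQ].
      apply (ex_derive_continuous G v). eexists. apply HG.
    - rewrite Qa, Qb in E. unfold G in E at 2. rewrite RInt_point in E. change zero with 0 in E. lra. }
  rewrite <- HGP. unfold G. apply (RInt_correct (V := R_CompleteNormedModule)).
  apply (ex_RInt_continuous (V := R_CompleteNormedModule)). intros; apply Cg.
Qed.

Lemma C_RInt_of_primitive (f P : R -> C) (a b fa fb : C) :
  (forall v, 0 < v < PI -> deriv_C P v (f v)) ->
  (forall v, 0 < v < PI -> cont_C f v) ->
  lim_C f (at_right 0) fa -> lim_C f (at_left PI) fb ->
  lim_C P (at_right 0) a -> lim_C P (at_left PI) b ->
  C_Rintegrable f 0 PI /\ C_RInt f 0 PI = (b - a)%C.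
Proof.
  intros HP Hf [A1 A2] [B1 B2] [C1 C2] [D1 D2].
  assert (H : @is_RInt C_R_NormedModule f 0 PI (b - a)%C).
  { replace (b - a)%C with (Re b - Re a, Im b - Im a) by reflexivity.
    apply is_RInt_fct_extend_pair.
    - apply (RInt_of_primitive (fun v => Re (f v)) (fun v => Re (P v)) (Re a) (Re b) (Re fa) (Re fb));
      try assumption; intros v Hv; [apply HP, Hv | apply Hf, Hv].
    - apply (RInt_of_primitive (fun v => Im (f v)) (fun v => Im (P v)) (Im a) (Im b) (Im fa) (Im fb));
      try assumption; intros v Hv; [apply HP, Hv | apply Hf, Hv]. }
  split; [eexists; exact H|].
  apply (is_RInt_unique (V := C_R_CompleteNormedModule)). exact H.
Qed.

(** * The two kernels *)

Lemma lim_right_const (a : C) : lim_right (fun _ => a) a.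
Proof.
  intros eps He. exists 0. intros x _ _. replace (a - a)%C with (RtoC 0) by ring. now rewrite Cmod_0.
Qed.

Lemma lim_right_ext (f g : C -> C) (L : C) (M0 : R) :
  (forall x, M0 <= Re x -> Rabs (Im x) <= PI -> f x = g x) -> lim_right f L -> lim_right g L.
Proof.
  intros E H eps He. destruct (H eps He) as [M HM]. exists (Rmax M M0). intros x Hx Hi.
  rewrite <- E; [|eapply Rle_trans; [apply Rmax_r | exact Hx] | exact Hi].
  apply HM; [eapply Rle_trans; [apply Rmax_l | exact Hx] | exact Hi].
Qed.

Lemma lim_right_plus (f g : C -> C) (L M : C) :
  lim_right f L -> lim_right g M -> lim_right (fun x => f x + g x)%C (L + M)%C.
Proof.
  intros Hf Hg eps He.
  destruct (Hf (eps / 2) ltac:(lra)) as [A HA]. destruct (Hg (eps / 2) ltac:(lra)) as [B HB].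
  exists (Rmax A B). intros x Hx Hi.
  specialize (HA x ltac:(eapply Rle_trans; [apply Rmax_l | exact Hx]) Hi).
  specialize (HB x ltac:(eapply Rle_trans; [apply Rmax_r | exact Hx]) Hi).
  replace (f x + g x - (L + M))%C with ((f x - L) + (g x - M))%C by ring.
  eapply Rle_lt_trans; [apply Cmod_triangle|]. lra.
Qed.

Lemma lim_right_mult (f g : C -> C) (L M : C) :
  lim_right f L -> lim_right g M -> lim_right (fun x => f x * g x)%C (L * M)%C.
Proof.
  intros Hf Hg eps He.
  assert (PL := Cmod_ge_0 L). assert (PM := Cmod_ge_0 M).
  set (e1 := eps / (2 * (Cmod M + 1))). set (e2 := eps / (2 * (Cmod L + 1))).
  assert (P1 : 0 < e1) by (apply Rdiv_lt_0_compat; lra).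
  assert (P2 : 0 < e2) by (apply Rdiv_lt_0_compat; lra).
  destruct (Hf (Rmin 1 e1) ltac:(apply Rmin_pos; lra)) as [A HA]. destruct (Hg e2 P2) as [B HB].
  exists (Rmax A B). intros x Hx Hi.
  specialize (HA x ltac:(eapply Rle_trans; [apply Rmax_l | exact Hx]) Hi).
  specialize (HB x ltac:(eapply Rle_trans; [apply Rmax_r | exact Hx]) Hi).
  assert (A1 := Rmin_l 1 e1). assert (A2 := Rmin_r 1 e1).
  replace (f x * g x - L * M)%C with ((f x - L) * M + ((f x - L) + L) * (g x - M))%C by ring.
  eapply Rle_lt_trans; [apply Cmod_triangle|]. rewrite !Cmod_mult.
  assert (T := Cmod_triangle (f x - L) L).
  assert (Q1 := Cmod_ge_0 (f x - L)%C). assert (Q2 := Cmod_ge_0 (g x - M)%C).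
  assert (Q3 := Cmod_ge_0 (f x - L + L)%C).
  assert (B1 : Cmod (f x - L)%C * Cmod M <= e1 * Cmod M) by (apply Rmult_le_compat_r; lra).
  assert (B2 : Cmod (f x - L + L)%C * Cmod (g x - M)%C <= (Cmod L + 1) * e2) by (apply Rmult_le_compat; lra).
  assert (E1 : e1 * (Cmod M + 1) = eps / 2) by (unfold e1; field; lra).
  assert (E2 : (Cmod L + 1) * e2 = eps / 2) by (unfold e2; field; lra).
  lra.
Qed.

Lemma lim_right_inv (f : C -> C) : lim_right f 1 -> lim_right (fun x => / f x)%C 1.
Proof.
  intros Hf eps He.
  destruct (Hf (Rmin (1 / 2) (eps / 2)) ltac:(apply Rmin_pos; lra)) as [M HM].
  exists M. intros x Hx Hi. specialize (HM x Hx Hi).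
  assert (A1 := Rmin_l (1 / 2) (eps / 2)). assert (A2 := Rmin_r (1 / 2) (eps / 2)).
  assert (Hn : 1 / 2 <= Cmod (f x)).
  { assert (T := Cmod_triangle (f x) (1 - f x)).
    replace (f x + (1 - f x))%C with (RtoC 1) in T by ring. rewrite Cmod_1 in T.
    replace (1 - f x)%C with (- (f x - 1))%C in T by ring. rewrite Cmod_opp in T. lra. }
  assert (Hz : f x <> 0%C) by (intros E; rewrite E, Cmod_0 in Hn; lra).
  replace (/ f x - 1)%C with (- (f x - 1) * / f x)%C by (field; exact Hz).
  rewrite Cmod_mult, Cmod_opp, Cmod_inv by exact Hz.
  apply Rle_lt_trans with (Cmod (f x - 1)%C * 2); [|lra].
  apply Rmult_le_compat_l; [apply Cmod_ge_0|].
  replace 2 with (/ (1 / 2)) by field. apply Rinv_le_contravar; lra.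
Qed.

Lemma lim_right_div (f : C -> C) (a : C) (K : R) :
  (forall x, Re a + 1 <= Re x -> Cmod (f x * (a - x))%C <= K) -> lim_right f 0.
Proof.
  intros H eps He.
  assert (PK := Rabs_pos K).
  exists (Re a + 1 + Rabs K / eps). intros x Hx _.
  assert (P0 : 0 <= Rabs K / eps) by (apply Rdiv_le_0_compat; lra).
  specialize (H x ltac:(lra)). rewrite Cmod_mult in H.
  assert (T := re_le_Cmod (a - x)%C).
  assert (E : Re (a - x)%C = Re a - Re x) by (destruct a, x; simpl; ring).
  rewrite E, Rabs_left1 in T by lra.
  replace (f x - 0)%C with (f x) by ring.
  assert (P := Cmod_ge_0 (f x)). assert (RK := Rle_abs K).
  apply Rnot_le_lt. intros C.
  assert (X : eps * (Rabs K / eps) = Rabs K) by (field; lra).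
  assert (eps * (1 + Rabs K / eps) <= Cmod (f x) * Cmod (a - x)%C) by (apply Rmult_le_compat; lra).
  lra.
Qed.

Lemma lim_right_inv_id : lim_right (fun x => / x)%C 0.
Proof.
  apply (lim_right_div _ 0 1). intros x Hx.
  assert (x <> 0%C) by (intros E; rewrite E in Hx; simpl in Hx; lra).
  replace (/ x * (0 - x))%C with (- (1))%C by (field; assumption).
  rewrite Cmod_opp, Cmod_1. lra.
Qed.

(** The quotient (x e^x - w e^w) / ((x - w) e^x) with its singularity at w removed. *)
Definition slope (w x : C) : C := (1 + w * exp_moment 0 (w - x))%C.

(** (x - w) e^x / (x e^x - w e^w): the factor x - w cancels the pole at w. *)
Definition kernel1 (w x : C) : C := (/ slope w x)%C.

(** (1 + x) kernel1(x) / (w x) - 1 / (z x) with z = w e^w, in a form that has no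
    singularity at 0. *)
Definition kernel2 (w x : C) : C :=
  (((1 + x) * (w * Cexp w * exp_moment 0 (0 - x) + 1) * kernel1 w x - (x + 1 - w)) * / (w * (w * Cexp w)))%C.

Lemma slope_eq (w x : C) : (slope w x * (x - w))%C = (x - w * Cexp (w - x))%C.
Proof.
  unfold slope. assert (E := mul_exp_moment_0 (w - x)).
  replace ((1 + w * exp_moment 0 (w - x)) * (x - w))%C with ((x - w) - w * ((w - x) * exp_moment 0 (w - x)))%C by ring.
  rewrite E. ring.
Qed.

Lemma exp_moment_0_at_0 : exp_moment 0 0 = 1%C.
Proof.
  unfold exp_moment. rewrite (int01_ext _ (fun _ => 1%C)).
  - rewrite (int01_deriv RtoC); [ring | intros; apply deriv_C_id | intros; apply cont_C_const].
  - intros s. replace (RtoC s * 0)%C with (RtoC 0) by ring. rewrite Cexp_0. simpl pow. ring.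
Qed.

Lemma Cexp_minus (x y : C) : (Cexp (x - y) * Cexp y)%C = Cexp x.
Proof. rewrite <- Cexp_plus. f_equal. ring. Qed.

(** A zero x <> w would be a second solution of x e^x = w e^w in the region, and w
    itself is a zero only if w = -1, in which case w e^w = - 1/e is on the slit. *)
Lemma slope_neq_0 (w x : C) :
  slit_plane 0 (w * Cexp w)%C -> region w -> region x -> slope w x <> 0%C.
Proof.
  intros HS Hw Hx E. assert (A := slope_eq w x). rewrite E, Cmult_0_l in A.
  assert (B : x = (w * Cexp (w - x))%C).
  { replace x with ((x - w * Cexp (w - x)) + w * Cexp (w - x))%C at 1 by ring. rewrite <- A. ring. }
  assert (X : (x * Cexp x = w * Cexp w)%C).
  { rewrite B at 1. rewrite <- (Cexp_minus w x). ring. }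
  assert (Y : x = w) by (apply mul_exp_inj; try assumption; now rewrite X).
  subst x. unfold slope in E. replace (w - w)%C with (RtoC 0) in E by ring. rewrite exp_moment_0_at_0 in E.
  assert (W : w = (- (1))%C).
  { replace w with ((1 + w * 1) - 1)%C by ring. rewrite E. ring. }
  apply HS. rewrite W. unfold Cexp; simpl.
  assert (Z : - 0 = 0) by ring. rewrite Z, sin_0, cos_0.
  split; [ring|]. assert (P := exp_pos (- (1))). lra.
Qed.

Lemma kernel1_hol (w : C) : hol (fun x => slope w x <> 0%C) (kernel1 w).
Proof.
  apply hol_inv; [intros x H; exact H|].
  apply hol_plus; [apply hol_const|]. apply hol_mult; [apply hol_const | apply hol_exp_moment].
Qed.

Lemma kernel2_hol (w : C) : hol (fun x => slope w x <> 0%C) (kernel2 w).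
Proof.
  apply hol_mult; [|apply hol_const].
  apply hol_minus.
  - apply hol_mult; [|apply kernel1_hol].
    apply hol_mult; [apply hol_plus; [apply hol_const | apply hol_id]|].
    apply hol_plus; [|apply hol_const].
    apply hol_mult; [apply hol_const | apply hol_exp_moment].
  - apply hol_minus; [|apply hol_const].
    apply hol_plus; [apply hol_id | apply hol_const].
Qed.

Lemma slope_open (w : C) : open (fun x => slope w x <> 0%C).
Proof.
  apply open_neq_0. intros x. apply cont_C_plus; [apply cont_C_const|]. apply cont_C_mult; [apply cont_C_const|].
  apply (cont_C_comp (fun y => w - y)%C); [apply cont_C_minus; [apply cont_C_const | apply cont_C_id] | apply exp_moment_cont].
Qed.

Lemma slope_lim (w : C) : lim_right (slope w) 1.
Proof.
  unfold slope.
  assert (E : lim_right (fun x => exp_moment 0 (w - x)) 0).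
  { apply (lim_right_div _ w 2). intros x Hx. rewrite Cmult_comm, mul_exp_moment_0.
    replace (Cexp (w - x) - 1)%C with (Cexp (w - x) + - (1))%C by ring.
    eapply Rle_trans; [apply Cmod_triangle|]. rewrite Cmod_opp, Cmod_1, Cmod_Cexp.
    assert (A : Re (w - x)%C <= 0) by (destruct w, x; simpl in *; lra).
    assert (B := exp_mono _ _ A). rewrite exp_0 in B. lra. }
  assert (T := lim_right_plus _ _ _ _ (lim_right_const 1) (lim_right_mult _ _ _ _ (lim_right_const w) E)).
  simpl in T. replace (1 + w * 0)%C with (RtoC 1) in T by ring. exact T.
Qed.

Lemma kernel1_lim (w : C) : lim_right (kernel1 w) 1.
Proof. apply lim_right_inv, slope_lim. Qed.

(** The product x (z E(-x) + 1), with E(x) = (e^x - 1) / x and z = w e^w, equals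
    z + slope(x) (x - w). This exhibits kernel2 as the announced kernel with its
    pole at 0 subtracted, and gives its limit on the right. *)
Lemma kernel2_eq (w x : C) : w <> 0%C -> x <> 0%C -> slope w x <> 0%C ->
  kernel2 w x = (kernel1 w x * / w + (kernel1 w x * / w - / (w * Cexp w)) * / x)%C.
Proof.
  intros Hw Hx HB. assert (A := slope_eq w x). assert (E := mul_exp_moment_0 (0 - x)).
  assert (X : Cexp (w - x) = (Cexp w * Cexp (0 - x))%C) by (rewrite <- Cexp_plus; f_equal; ring).
  rewrite X in A.
  assert (HE := Cexp_neq_0 w).
  set (e := exp_moment 0 (0 - x)) in *. set (z := Cexp w) in *.
  assert (F : (x * (w * z * e + 1) = w * z + slope w x * (x - w))%C).
  { rewrite A. replace (Cexp (0 - x)) with (1 + (0 - x) * e)%C by (rewrite E; ring). ring. }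
  assert (G : (w * z * e + 1 = (w * z + slope w x * (x - w)) * / x)%C).
  { rewrite <- F. field. exact Hx. }
  unfold kernel2. fold e z. rewrite G. unfold kernel1. field. repeat split; assumption.
Qed.

Lemma kernel2_lim (w : C) : w <> 0%C -> lim_right (kernel2 w) (/ w)%C.
Proof.
  intros Hw.
  assert (T : lim_right (fun x => kernel1 w x * / w + (kernel1 w x * / w - / (w * Cexp w)) * / x)%C
                (1 * / w + (1 * / w + - / (w * Cexp w)) * 0)%C).
  { apply lim_right_plus; [apply lim_right_mult; [apply kernel1_lim | apply lim_right_const]|].
    apply lim_right_mult; [|apply lim_right_inv_id].
    apply (lim_right_plus (fun x => kernel1 w x * / w)%C (fun _ => - / (w * Cexp w))%C); [|apply lim_right_const].
    apply lim_right_mult; [apply kernel1_lim | apply lim_right_const]. }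
  replace (1 * / w + (1 * / w + - / (w * Cexp w)) * 0)%C with (/ w)%C in T by ring.
  destruct (slope_lim w 1 Rlt_0_1) as [M HM].
  refine (lim_right_ext _ _ _ (Rmax 1 M) _ T). intros x Hx Hi. symmetry. apply kernel2_eq; [exact Hw | |].
  - intros E. rewrite E in Hx. assert (A := Rmax_l 1 M). simpl in Hx. lra.
  - intros E. specialize (HM x ltac:(eapply Rle_trans; [apply Rmax_r | exact Hx]) Hi).
    rewrite E in HM. replace (0 - 1)%C with (- (1))%C in HM by ring.
    rewrite Cmod_opp, Cmod_1 in HM. lra.
Qed.

(** * Values of the kernels on the boundary curve *)

Lemma slope_diag (w : C) : slope w w = (1 + w)%C.
Proof. unfold slope. replace (w - w)%C with (RtoC 0) by ring. rewrite exp_moment_0_at_0. ring. Qed.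

(** The reciprocal of the modulus of x e^x at the boundary point curve v. *)
Definition tau (v : R) : R := exp (v * cot v) * (sin v / v).

Lemma tau_pos (v : R) : 0 < v < PI -> 0 < tau v.
Proof.
  intros Hv. apply Rmult_lt_0_compat; [apply exp_pos|].
  apply Rdiv_lt_0_compat; [apply sin_gt_0|]; lra.
Qed.

Lemma curve_mul_exp (v : R) : 0 < v < PI -> (RtoC (tau v) * (curve v * Cexp (curve v)))%C = (- (1))%C.
Proof.
  intros Hv. assert (S : 0 < sin v) by (apply sin_gt_0; lra).
  assert (F := sin2_cos2 v). unfold Rsqr in F.
  assert (X : exp (v * cot v) * exp (- (v * cot v)) = 1) by (rewrite <- exp_plus, Rplus_opp_r; apply exp_0).
  replace (RtoC (tau v) * (curve v * Cexp (curve v)))%C with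
    (RtoC (exp (v * cot v) * exp (- (v * cot v))) *
      (RtoC (sin v / v) * (curve v * (cos v, sin v))))%C.
  - rewrite X. unfold curve, vertical, cot. apply injective_projections; simpl; field_simplify_eq; try lra.
    assert (E : cos v ^ 2 = 1 - sin v ^ 2) by (simpl; lra). rewrite ?E. ring.
  - unfold tau, Cexp. rewrite !RtoC_mult.
    replace (exp (Re (curve v)) * cos (Im (curve v)), exp (Re (curve v)) * sin (Im (curve v)))
      with (RtoC (exp (- (v * cot v))) * (cos v, sin v))%C.
    + ring.
    + apply injective_projections; simpl; ring.
Qed.

Lemma one_plus_neq_0 (z : C) (t : R) : slit_plane 0 z -> 0 <= t -> (1 + z * RtoC t)%C <> 0%C.
Proof.
  intros HS Ht E. apply HS. destruct z as [a b].
  assert (E1 := f_equal Re E). assert (E2 := f_equal Im E). simpl in E1, E2 |- *.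
  assert (T : t <> 0) by (intros ->; lra).
  split; [|nra]. assert (b * t = 0) by lra.
  apply Rmult_integral in H as [H|H]; [exact H | contradiction].
Qed.

(** Here e^(-x) = - t x, so that the transcendental denominator x - w e^(w - x) of
    kernel1 becomes x (1 + t w e^w). *)
Lemma kernel1_on_curve (w x : C) (t : R) :
  slit_plane 0 (w * Cexp w)%C -> 0 <= t -> slope w x <> 0%C ->
  (RtoC t * (x * Cexp x) = - (1))%C ->
  x <> 0%C /\ kernel1 w x = ((x - w) / (x * (1 + w * Cexp w * RtoC t)))%C.
Proof.
  intros HS Ht HB E.
  assert (Hx : x <> 0%C).
  { intros Z. rewrite Z in E. apply C1_nz. replace (RtoC 1) with (- (RtoC t * (0 * Cexp 0)))%C; [ring|].
    rewrite E. ring. }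
  split; [exact Hx|].
  assert (N := one_plus_neq_0 _ t HS Ht).
  assert (A := slope_eq w x).
  assert (X : Cexp (w - x) = (- (Cexp w * (RtoC t * x)))%C).
  { transitivity (- (Cexp (w - x)) * (RtoC t * (x * Cexp x)))%C; [rewrite E; ring|].
    rewrite <- (Cexp_minus w x). ring. }
  rewrite X in A.
  assert (Y : (slope w x * (x - w) = x * (1 + w * Cexp w * RtoC t))%C) by (rewrite A; ring).
  assert (P : (x * (1 + w * Cexp w * RtoC t))%C <> 0%C) by (apply Cmult_neq_0; assumption).
  assert (Q : (x - w)%C <> 0%C) by (intros Z; apply P; rewrite <- Y, Z; ring).
  unfold kernel1. rewrite <- Y. field. split; assumption.
Qed.

(** The last two relations say that dx = x (1/v - cot v - i) dv on the curve, the
    logarithmic derivative of x = (v / sin v) e^(i (PI - v)). *)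
Lemma curve_algebra (v : R) : 0 < v < PI -> exists V K : C,
  V = RtoC v /\ K = RtoC (cot v) /\ V <> 0%C /\
  curve v = (- (V * K) + Ci * V)%C /\ Cconj (curve v) = (- (V * K) - Ci * V)%C /\
  dcurve v = (curve v * ((1 - V * K) / V - Ci))%C /\
  Cconj (dcurve v) = (Cconj (curve v) * ((1 - V * K) / V + Ci))%C.
Proof.
  intros Hv. assert (S : 0 < sin v) by (apply sin_gt_0; lra).
  assert (F := sin2_cos2 v). unfold Rsqr in F.
  exists (RtoC v), (RtoC (cot v)).
  assert (HV : RtoC v <> 0%C) by (intros E; apply RtoC_inj in E; lra).
  assert (E : ((1 - RtoC v * RtoC (cot v)) / RtoC v)%C = RtoC (/ v - cot v)).
  { rewrite RtoC_minus, RtoC_inv by lra. field. exact HV. }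
  assert (R : v / (sin v * sin v) = v * (cot v * cot v + 1)).
  { unfold cot. field_simplify_eq; [|lra]. assert (E2 : cos v ^ 2 = 1 - sin v ^ 2) by (simpl; lra).
    rewrite ?E2. ring. }
  rewrite !E. unfold curve, vertical, dcurve. rewrite R.
  repeat split; try exact HV; apply injective_projections; simpl; field; lra.
Qed.

Definition resolvent (z : C) (t : R) : C := (/ (1 + z * RtoC t))%C.

Lemma integrand1_eq (z : C) (v : R) : integrand1 z v = resolvent z (tau v).
Proof.
  unfold integrand1, resolvent, tau. rewrite RtoC_mult. unfold Cdiv. rewrite Cmult_1_l.
  f_equal. f_equal. ring.
Qed.

Lemma curve_neq_0 (w : C) (v : R) : slit_plane 0 (w * Cexp w)%C -> region w -> 0 < v < PI ->
  slope w (curve v) <> 0%C /\ slope w (Cconj (curve v)) <> 0%C.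
Proof.
  intros HS Hw Hv. assert (region (curve v)) by (apply region_vertical; lra).
  split; apply slope_neq_0; try assumption. now apply region_conj.
Qed.

Lemma curve_conj_mul_exp (v : R) : 0 < v < PI ->
  (RtoC (tau v) * (Cconj (curve v) * Cexp (Cconj (curve v))))%C = (- (1))%C.
Proof.
  intros Hv. rewrite mul_exp_conj.
  assert (E := f_equal Cconj (curve_mul_exp v Hv)). rewrite Cmult_conj in E.
  replace (Cconj (RtoC (tau v))) with (RtoC (tau v)) in E by (apply injective_projections; simpl; ring).
  rewrite E. apply injective_projections; simpl; ring.
Qed.

Lemma Ci_sqr : (Ci * Ci)%C = (- (1))%C.
Proof. apply injective_projections; simpl; ring. Qed.

(** On the curve kernel1 dx is the first integrand times (1 - w / x) dx. Between the
    conjugate points dx contributes 2 i dv and dx / x contributes - 2 i dv, whence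
    the constant factor 2 i (1 + w). *)
Lemma kernel1_jump (w : C) (v : R) : slit_plane 0 (w * Cexp w)%C -> region w -> 0 < v < PI ->
  (kernel1 w (curve v) * dcurve v - kernel1 w (Cconj (curve v)) * Cconj (dcurve v))%C =
  (2 * Ci * (1 + w) * integrand1 (w * Cexp w) v)%C.
Proof.
  intros HS Hw Hv. destruct (curve_neq_0 w v HS Hw Hv) as [B1 B2].
  assert (T := tau_pos v Hv).
  destruct (kernel1_on_curve w _ (tau v) HS (Rlt_le _ _ T) B1 (curve_mul_exp v Hv)) as [Z1 K1].
  destruct (kernel1_on_curve w _ (tau v) HS (Rlt_le _ _ T) B2 (curve_conj_mul_exp v Hv)) as [Z2 K2].
  assert (N := one_plus_neq_0 _ (tau v) HS (Rlt_le _ _ T)).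
  rewrite K1, K2, integrand1_eq. unfold resolvent.
  destruct (curve_algebra v Hv) as (V & K & _ & _ & HV & E1 & E2 & E3 & E4).
  rewrite E4, E3.
  set (n := (1 + w * Cexp w * RtoC (tau v))%C) in *.
  transitivity (((curve v - w) * ((1 - V * K) / V - Ci) - (Cconj (curve v) - w) * ((1 - V * K) / V + Ci)) * / n)%C.
  - field. repeat split; assumption.
  - f_equal. rewrite E2, E1. field_simplify_eq; [|exact HV]. ring [Ci_sqr].
Qed.

(** The quotient |1 + x|^2 / |x|^2 at the boundary point curve v. *)
Definition weight (v : R) : R := (v ^ 2 + (1 - v * cot v) ^ 2) / (v ^ 2 + (v * cot v) ^ 2).

Lemma integrand2_eq (z : C) (v : R) : slit_plane 0 z -> 0 < v < PI ->
  integrand2 z v = (RtoC (weight v) * resolvent z (tau v))%C.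
Proof.
  intros HS Hv. assert (S : 0 < sin v) by (apply sin_gt_0; lra).
  assert (F := sin2_cos2 v). unfold Rsqr in F.
  assert (T := tau_pos v Hv).
  assert (N := one_plus_neq_0 _ (tau v) HS (Rlt_le _ _ T)).
  assert (M : v ^ 2 + (v * cot v) ^ 2 = v * csc v * (v * csc v)).
  { unfold cot, csc. field_simplify_eq; [|lra]. assert (E2 : cos v ^ 2 = 1 - sin v ^ 2) by (simpl; lra).
    rewrite ?E2. ring. }
  assert (C0 : v * csc v <> 0).
  { unfold csc. assert (0 < v * (1 / sin v)); [|lra]. apply Rmult_lt_0_compat; [lra|].
    apply Rdiv_lt_0_compat; lra. }
  assert (X : exp (v * cot v) = v * csc v * tau v) by (unfold csc, tau; field; lra).
  unfold integrand2, weight, resolvent. rewrite M, X.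
  set (m := v * csc v) in *.
  assert (C1 : RtoC m <> 0%C) by (intros E; apply RtoC_inj in E; lra).
  unfold Rdiv. rewrite !RtoC_mult, RtoC_inv, RtoC_mult by (apply Rmult_integral_contrapositive_currified; assumption).
  field. repeat split; try assumption.
  replace (RtoC m + z * (RtoC m * RtoC (tau v)))%C with (RtoC m * (1 + z * RtoC (tau v)))%C by ring.
  apply Cmult_neq_0; assumption.
Qed.

(** The contributions of dx, dx / x and dx / x^2 to (1 + x)(x - w) / (w x^2) dx
    combine into 2 i times the weight |1 + x|^2 / |x|^2, from which w has
    disappeared; the pole - 1 / (z x) contributes 2 i / z. *)
Lemma kernel2_jump (w : C) (v : R) : slit_plane 0 (w * Cexp w)%C -> w <> 0%C -> region w -> 0 < v < PI ->
  (kernel2 w (curve v) * dcurve v - kernel2 w (Cconj (curve v)) * Cconj (dcurve v))%C =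
  (2 * Ci * (integrand2 (w * Cexp w) v + / (w * Cexp w)))%C.
Proof.
  intros HS Hw0 Hw Hv. destruct (curve_neq_0 w v HS Hw Hv) as [B1 B2].
  assert (T := tau_pos v Hv).
  destruct (kernel1_on_curve w _ (tau v) HS (Rlt_le _ _ T) B1 (curve_mul_exp v Hv)) as [Z1 K1].
  destruct (kernel1_on_curve w _ (tau v) HS (Rlt_le _ _ T) B2 (curve_conj_mul_exp v Hv)) as [Z2 K2].
  assert (N := one_plus_neq_0 _ (tau v) HS (Rlt_le _ _ T)).
  assert (NE := Cexp_neq_0 w).
  rewrite !kernel2_eq by assumption.
  rewrite K1, K2, integrand2_eq by assumption. unfold resolvent.
  assert (M : (RtoC (weight v) = (RtoC v * RtoC v + (1 - RtoC v * RtoC (cot v)) * (1 - RtoC v * RtoC (cot v))) /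
       (curve v * Cconj (curve v)))%C).
  { unfold weight. unfold Rdiv. rewrite RtoC_mult, RtoC_inv.
    2: assert (A1 := pow2_ge_0 (v * cot v)); assert (A2 := pow_lt v 2 (proj1 Hv)); lra.
    unfold Cdiv. f_equal.
    - apply injective_projections; simpl; ring.
    - f_equal. unfold curve, vertical. apply injective_projections; simpl; ring. }
  rewrite M. clear M.
  destruct (curve_algebra v Hv) as (V & K & <- & <- & HV & E1 & E2 & E3 & E4).
  rewrite E4, E3.
  set (n := (1 + w * Cexp w * RtoC (tau v))%C) in *. set (e := Cexp w) in *.
  set (a := curve v) in *. set (b := Cconj a) in *.
  clearbody n e.
  transitivity ((((1 - V * K) / V - Ci) * ((1 - w) + a - w / a) - ((1 - V * K) / V + Ci) * ((1 - w) + b - w / b))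
                  * / (w * n) + 2 * Ci * / (w * e))%C.
  - field. repeat split; assumption.
  - transitivity (2 * Ci * (w * (V * V + (1 - V * K) * (1 - V * K)) / (a * b)) * / (w * n) + 2 * Ci * / (w * e))%C;
    [|field; repeat split; assumption].
    f_equal. f_equal.
    transitivity ((((1 - V * K) / V - Ci) * ((1 - w) * (a * b) + a * (a * b) - w * b)
       - ((1 - V * K) / V + Ci) * ((1 - w) * (a * b) + b * (a * b) - w * a)) * / (a * b))%C.
    + field. repeat split; assumption.
    + transitivity ((2 * Ci * (w * (V * V + (1 - V * K) * (1 - V * K)))) * / (a * b))%C;
      [|field; split; assumption].
      f_equal. rewrite E2, E1. field_simplify_eq; [|exact HV]. ring [Ci_sqr].
Qed.

(** * Evaluation of the integrals *)

Lemma lim_mult {F : (R -> Prop) -> Prop} {FF : Filter F} (f g : R -> R) (a b : R) :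
  filterlim f F (locally a) -> filterlim g F (locally b) ->
  filterlim (fun v => f v * g v) F (locally (a * b)).
Proof.
  intros Hf Hg. eapply filterlim_comp_2; [exact Hf | exact Hg |].
  apply (filterlim_mult (K := R_AbsRing)).
Qed.

Lemma lim_plus {F : (R -> Prop) -> Prop} {FF : Filter F} (f g : R -> R) (a b : R) :
  filterlim f F (locally a) -> filterlim g F (locally b) ->
  filterlim (fun v => f v + g v) F (locally (a + b)).
Proof.
  intros Hf Hg. eapply filterlim_comp_2; [exact Hf | exact Hg |].
  apply (filterlim_plus (V := R_NormedModule)).
Qed.

Lemma lim_opp {F : (R -> Prop) -> Prop} {FF : Filter F} (f : R -> R) (a : R) :
  filterlim f F (locally a) -> filterlim (fun v => - f v) F (locally (- a)).
Proof.
  intros Hf. eapply filterlim_comp; [exact Hf |]. apply (filterlim_opp (V := R_NormedModule)).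
Qed.

Lemma lim_C_mult {F : (R -> Prop) -> Prop} {FF : Filter F} (f g : R -> C) (a b : C) :
  lim_C f F a -> lim_C g F b -> lim_C (fun v => f v * g v)%C F (a * b)%C.
Proof.
  intros [A1 A2] [B1 B2]. split.
  - apply (lim_plus (fun v => Re (f v) * Re (g v)) (fun v => - (Im (f v) * Im (g v)))).
    + apply lim_mult; assumption.
    + apply (lim_opp (fun v => Im (f v) * Im (g v))), lim_mult; assumption.
  - apply (lim_plus (fun v => Re (f v) * Im (g v)) (fun v => Im (f v) * Re (g v)));
    apply lim_mult; assumption.
Qed.

Lemma lim_C_minus {F : (R -> Prop) -> Prop} {FF : Filter F} (f g : R -> C) (a b : C) :
  lim_C f F a -> lim_C g F b -> lim_C (fun v => f v - g v)%C F (a - b)%C.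
Proof.
  intros [A1 A2] [B1 B2]. split.
  - apply (lim_plus (fun v => Re (f v)) (fun v => - Re (g v))); [exact A1 | apply lim_opp, B1].
  - apply (lim_plus (fun v => Im (f v)) (fun v => - Im (g v))); [exact A2 | apply lim_opp, B2].
Qed.

Lemma lim_C_comp {F : (R -> Prop) -> Prop} (f : R -> R) (h : R -> C) (t : R) :
  filterlim f F (locally t) -> cont_C h t -> lim_C (fun v => h (f v)) F (h t).
Proof.
  intros Hf [A B]; split.
  - exact (filterlim_comp _ _ _ f (fun s => Re (h s)) _ _ _ Hf A).
  - exact (filterlim_comp _ _ _ f (fun s => Im (h s)) _ _ _ Hf B).
Qed.

Lemma lim_C_const (F : (R -> Prop) -> Prop) {FF : Filter F} (a : C) : lim_C (fun _ => a) F a.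
Proof. split; apply filterlim_const. Qed.

Lemma lim_C_RtoC (F : (R -> Prop) -> Prop) {FF : Filter F} (f : R -> R) (t : R) :
  filterlim f F (locally t) -> lim_C (fun v => RtoC (f v)) F (RtoC t).
Proof. intros H. split; [exact H | apply filterlim_const]. Qed.

Lemma lim_C_ext {F : (R -> Prop) -> Prop} {FF : Filter F} (f g : R -> C) (a : C) :
  F (fun v => f v = g v) -> lim_C f F a -> lim_C g F a.
Proof.
  intros E [A B]; split.
  - apply (filterlim_ext_loc (fun v => Re (f v))); [|exact A].
    exact (filter_imp _ _ (fun s Hs => f_equal Re Hs) E).
  - apply (filterlim_ext_loc (fun v => Im (f v))); [|exact B].
    exact (filter_imp _ _ (fun s Hs => f_equal Im Hs) E).
Qed.

Lemma near_0 : at_right 0 (fun v => 0 < v < PI).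
Proof. apply (at_right_0 _ PI PI_RGT_0). auto. Qed.

Lemma near_PI : at_left PI (fun v => 0 < v < PI).
Proof. apply (at_left_PI _ PI PI_RGT_0). intros v Hv. lra. Qed.

Lemma lim_at_left (f : R -> R) (a : R) : continuous f a -> filterlim f (at_left a) (locally (f a)).
Proof. intros H. eapply filterlim_filter_le_1; [apply filter_le_within | exact H]. Qed.

Lemma lim_at_right (f : R -> R) (a : R) : continuous f a -> filterlim f (at_right a) (locally (f a)).
Proof. intros H. eapply filterlim_filter_le_1; [apply filter_le_within | exact H]. Qed.

Lemma sinc_lim_0 : filterlim (fun v => sin v / v) (at_right 0) (locally 1).
Proof.
  apply filterlim_locally. intros eps. assert (Pe := cond_pos eps).
  apply (at_right_0 _ (Rmin 1 eps)); [apply Rmin_pos; lra|].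
  intros v Hv. assert (A1 := Rmin_l 1 eps). assert (A2 := Rmin_r 1 eps).
  change (Rabs (sin v / v - 1) < eps).
  replace (sin v / v - 1) with ((sin v - v) / v) by (field; lra).
  unfold Rdiv. rewrite Rabs_mult, (Rabs_pos_eq (/ v)) by (apply Rlt_le, Rinv_0_lt_compat; lra).
  apply (Rmult_lt_reg_r v); [lra|]. rewrite Rmult_assoc, Rinv_l, Rmult_1_r by lra.
  assert (S := sin_minus_id v ltac:(rewrite Rabs_pos_eq; lra)).
  assert (v * v < eps * v) by (apply Rmult_lt_compat_r; lra). lra.
Qed.

Lemma v_cot_v_lim_0 : filterlim (fun v => v * cot v) (at_right 0) (locally 1).
Proof.
  apply filterlim_locally. intros eps. assert (Pe := cond_pos eps).
  apply (at_right_0 _ (Rmin (1 / 2) (eps / 4))); [apply Rmin_pos; lra|].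
  intros v Hv. assert (A1 := Rmin_l (1 / 2) (eps / 4)). assert (A2 := Rmin_r (1 / 2) (eps / 4)).
  assert (A := v_cot_v_near_0 v ltac:(lra)).
  change (Rabs (v * cot v - 1) < eps). lra.
Qed.

Lemma tau_lim_0 : filterlim tau (at_right 0) (locally (exp 1 * 1)).
Proof.
  apply (lim_mult (fun v => exp (v * cot v)) (fun v => sin v / v)); [|apply sinc_lim_0].
  eapply filterlim_comp; [apply v_cot_v_lim_0|]. apply continuous_exp.
Qed.

Lemma sinc_lim_PI : filterlim (fun v => sin v / v) (at_left PI) (locally 0).
Proof.
  assert (PP := PI_RGT_0). replace 0 with (sin PI / PI) by (rewrite sin_PI; field; lra).
  apply (lim_at_left (fun v => sin v / v)). apply continuous_of_ex_derive. auto_derive. lra.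
Qed.

Lemma tau_lim_PI : filterlim tau (at_left PI) (locally 0).
Proof.
  apply filterlim_locally. intros eps.
  assert (L := proj1 (filterlim_locally _ _) sinc_lim_PI eps).
  assert (N : at_left PI (fun v => PI - 1 < v < PI)) by (apply (at_left_PI _ 1); [lra | auto]).
  generalize (filter_and _ _ (filter_and _ _ L N) near_PI). apply filter_imp.
  intros v [[Hv H1] H2]. change (Rabs (sin v / v - 0) < eps) in Hv. change (Rabs (tau v - 0) < eps).
  rewrite Rminus_0_r in *. assert (T := tau_pos v H2). rewrite Rabs_pos_eq by lra.
  eapply Rle_lt_trans; [|exact Hv]. eapply Rle_trans; [|apply Rle_abs].
  assert (S : 0 < sin v / v) by (apply Rdiv_lt_0_compat; [apply sin_gt_0|]; lra).
  assert (B := v_cot_v_near_PI v ltac:(lra)).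
  assert (B0 : 0 < 1 / (PI - v)) by (apply Rdiv_lt_0_compat; lra).
  assert (X := exp_mono (v * cot v) 0 ltac:(lra)). rewrite exp_0 in X.
  unfold tau. nra.
Qed.

(** In this form the limits at 0 and PI can be read off from those of sin v / v. *)
Lemma weight_eq (v : R) : 0 < v < PI ->
  weight v = 1 + - (2 * cos v * (sin v / v)) + sin v / v * (sin v / v).
Proof.
  intros Hv. assert (S : 0 < sin v) by (apply sin_gt_0; lra).
  assert (F := sin2_cos2 v). unfold Rsqr in F.
  assert (E : v ^ 2 + (v * cot v) ^ 2 = v ^ 2 * / (sin v * sin v)).
  { unfold cot. field_simplify_eq; [|lra]. assert (E2 : cos v ^ 2 = 1 - sin v ^ 2) by (simpl; lra).
    rewrite ?E2. ring. }
  unfold weight.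
  replace (v ^ 2 + (1 - v * cot v) ^ 2) with (v ^ 2 + (v * cot v) ^ 2 + 1 - 2 * (v * cot v)) by ring.
  rewrite E. unfold cot. field. lra.
Qed.

Lemma weight_lim (F : (R -> Prop) -> Prop) {FF : Filter F} (c s : R) :
  F (fun v => 0 < v < PI) ->
  filterlim cos F (locally c) -> filterlim (fun v => sin v / v) F (locally s) ->
  filterlim weight F (locally (1 + - (2 * c * s) + s * s)).
Proof.
  intros N Hc Hs.
  apply (filterlim_ext_loc (fun v => 1 + - (2 * cos v * (sin v / v)) + sin v / v * (sin v / v))).
  { revert N. apply filter_imp. intros v Hv. symmetry. apply weight_eq, Hv. }
  apply lim_plus; [|apply lim_mult; assumption].
  apply lim_plus; [apply filterlim_const|].
  apply (lim_opp (fun v => 2 * cos v * (sin v / v))).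
  apply lim_mult; [|assumption]. apply lim_mult; [apply filterlim_const | assumption].
Qed.

Lemma resolvent_cont (z : C) (t : R) : slit_plane 0 z -> 0 <= t -> cont_C (resolvent z) t.
Proof.
  intros HS Ht. apply cont_C_inv; [|apply one_plus_neq_0; assumption].
  apply cont_C_plus; [apply cont_C_const|]. apply cont_C_mult; [apply cont_C_const|]. apply cont_C_RtoC, continuous_id.
Qed.

Lemma continuous_tau (v : R) : 0 < v < PI -> continuous tau v.
Proof.
  intros Hv. assert (S : 0 < sin v) by (apply sin_gt_0; lra).
  apply continuous_of_ex_derive. unfold tau, cot. auto_derive. repeat split; lra.
Qed.

Lemma resolvent_tau_cont (z : C) (v : R) : slit_plane 0 z -> 0 < v < PI -> cont_C (fun v => resolvent z (tau v)) v.
Proof.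
  intros HS Hv. apply cont_C_comp_R; [apply continuous_tau, Hv|].
  apply resolvent_cont; [exact HS | apply Rlt_le, tau_pos, Hv].
Qed.

Lemma resolvent_tau_lim_0 (z : C) : slit_plane 0 z -> lim_C (fun v => resolvent z (tau v)) (at_right 0) (resolvent z (exp 1 * 1)).
Proof.
  intros HS. apply lim_C_comp; [apply tau_lim_0 | apply resolvent_cont; [exact HS|]].
  assert (P := exp_pos 1). lra.
Qed.

Lemma resolvent_tau_lim_PI (z : C) : slit_plane 0 z -> lim_C (fun v => resolvent z (tau v)) (at_left PI) (resolvent z 0).
Proof. intros HS. apply lim_C_comp; [apply tau_lim_PI | apply resolvent_cont; [exact HS | lra]]. Qed.

Lemma cont_C_ext_0PI (f g : R -> C) (v : R) : 0 < v < PI ->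
  (forall x, 0 < x < PI -> f x = g x) -> cont_C f v -> cont_C g v.
Proof.
  intros Hv E [A B]. split.
  - apply (continuous_ext_loc _ (fun v => Re (f v))); [|exact A].
    apply locally_0PI; [exact Hv|]. intros x Hx. now rewrite E.
  - apply (continuous_ext_loc _ (fun v => Im (f v))); [|exact B].
    apply locally_0PI; [exact Hv|]. intros x Hx. now rewrite E.
Qed.

Lemma Ci_neq_0 : Ci <> 0%C.
Proof. intros E. apply (f_equal Im) in E. simpl in E. lra. Qed.

(** Up to the factor 2 i (1 + w) this is the integral of kernel1 along the whole
    curve, whose value is 2 PI i because kernel1 tends to 1 on the right. *)
Lemma first_integral (w : C) : slit_plane 0 (w * Cexp w)%C -> region w ->
  C_Rintegrable (integrand1 (w * Cexp w)) 0 PI /\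
  C_RInt (integrand1 (w * Cexp w)) 0 PI = (PI / (1 + w))%C.
Proof.
  intros HS Hw.
  assert (N : (1 + w)%C <> 0%C) by (rewrite <- slope_diag; apply slope_neq_0; assumption).
  assert (HD : forall x, region x -> slope w x <> 0%C) by (intros x Hx; apply slope_neq_0; assumption).
  assert (NI := Ci_neq_0).
  destruct (C_RInt_of_primitive (integrand1 (w * Cexp w)) (fun v => prim_gap (kernel1 w) v * / (2 * Ci * (1 + w)))%C
     (0 * / (2 * Ci * (1 + w)))%C (2 * PI * (1 * Ci) * / (2 * Ci * (1 + w)))%C
     (resolvent (w * Cexp w) (exp 1 * 1)) (resolvent (w * Cexp w) 0)) as [H1 H2].
  - intros v Hv. eapply deriv_C_val.
    + apply (deriv_C_mult (prim_gap (kernel1 w)) (fun _ => / (2 * Ci * (1 + w)))%C); [|apply deriv_C_const].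
      apply (prim_gap_deriv _ _ _ (slope_open w) (kernel1_hol w) HD Hv).
    + rewrite (kernel1_jump w v HS Hw Hv). field. split; assumption.
  - intros v Hv. apply (cont_C_ext_0PI (fun v => resolvent (w * Cexp w) (tau v))); [exact Hv | |apply resolvent_tau_cont; assumption].
    intros x _. symmetry. apply integrand1_eq.
  - apply (lim_C_ext (fun v => resolvent (w * Cexp w) (tau v))); [|apply resolvent_tau_lim_0, HS].
    apply filter_forall. intros x. symmetry. apply integrand1_eq.
  - apply (lim_C_ext (fun v => resolvent (w * Cexp w) (tau v))); [|apply resolvent_tau_lim_PI, HS].
    apply filter_forall. intros x. symmetry. apply integrand1_eq.
  - apply lim_C_mult; [|apply lim_C_const, _].
    apply (prim_gap_lim_0 _ _ (slope_open w) (kernel1_hol w) HD).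
  - apply lim_C_mult; [|apply lim_C_const, _].
    apply (prim_gap_lim_PI _ _ _ (slope_open w) (kernel1_hol w) HD (kernel1_lim w)).
  - split; [exact H1|]. rewrite H2. field. split; assumption.
Qed.

(** The integral of kernel2 along the whole curve is 2 PI i / w; the constant 1 / z
    that accompanies the integrand has the primitive v / z. *)
Lemma second_integral (w : C) : slit_plane 0 (w * Cexp w)%C -> region w -> w <> 0%C ->
  C_Rintegrable (integrand2 (w * Cexp w)) 0 PI /\
  C_RInt (integrand2 (w * Cexp w)) 0 PI = (PI * (/ w - / (w * Cexp w)))%C.
Proof.
  intros HS Hw Hw0.
  assert (HD : forall x, region x -> slope w x <> 0%C) by (intros x Hx; apply slope_neq_0; assumption).
  assert (NI := Ci_neq_0). assert (NE := Cexp_neq_0 w). assert (PP := PI_RGT_0).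
  set (z := (w * Cexp w)%C) in *.
  assert (Nz : z <> 0%C) by (apply Cmult_neq_0; assumption).
  assert (E : forall v, 0 < v < PI -> (RtoC (weight v) * resolvent z (tau v))%C = integrand2 z v)
    by (intros v Hv; symmetry; apply integrand2_eq; assumption).
  destruct (C_RInt_of_primitive (integrand2 z) (fun v => prim_gap (kernel2 w) v * / (2 * Ci) - RtoC v * / z)%C
     (0 * / (2 * Ci) - RtoC 0 * / z)%C (2 * PI * (/ w * Ci) * / (2 * Ci) - RtoC PI * / z)%C
     (RtoC (1 + - (2 * cos 0 * 1) + 1 * 1) * resolvent z (exp 1 * 1))%C
     (RtoC (1 + - (2 * cos PI * 0) + 0 * 0) * resolvent z 0)%C) as [H1 H2].
  - intros v Hv. eapply deriv_C_val.
    + apply (deriv_C_minus (fun v => prim_gap (kernel2 w) v * / (2 * Ci))%C (fun v => RtoC v * / z)%C).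
      * apply (deriv_C_mult (prim_gap (kernel2 w)) (fun _ => / (2 * Ci))%C); [|apply deriv_C_const].
        apply (prim_gap_deriv _ _ _ (slope_open w) (kernel2_hol w) HD Hv).
      * apply (deriv_C_mult RtoC (fun _ => / z)%C); [apply deriv_C_id | apply deriv_C_const].
    + rewrite (kernel2_jump w v HS Hw0 Hw Hv). fold z. field. split; assumption.
  - intros v Hv. apply (cont_C_ext_0PI (fun v => RtoC (weight v) * resolvent z (tau v))%C); [exact Hv | exact E |].
    apply cont_C_mult; [|apply resolvent_tau_cont; assumption].
    apply cont_C_RtoC.
    apply (continuous_ext_loc _ (fun v => 1 + - (2 * cos v * (sin v / v)) + sin v / v * (sin v / v))).
    + apply locally_0PI; [exact Hv|]. intros x Hx. symmetry. apply weight_eq, Hx.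
    + apply continuous_of_ex_derive. auto_derive. lra.
  - apply (lim_C_ext (fun v => RtoC (weight v) * resolvent z (tau v))%C).
    { generalize near_0. apply filter_imp. exact E. }
    apply lim_C_mult; [|apply resolvent_tau_lim_0, HS].
    apply lim_C_RtoC; [exact _|]. apply weight_lim; [exact _ | apply near_0 | | apply sinc_lim_0].
    apply lim_at_right, continuous_cos.
  - apply (lim_C_ext (fun v => RtoC (weight v) * resolvent z (tau v))%C).
    { generalize near_PI. apply filter_imp. exact E. }
    apply lim_C_mult; [|apply resolvent_tau_lim_PI, HS].
    apply lim_C_RtoC; [exact _|]. apply weight_lim; [exact _ | apply near_PI | | apply sinc_lim_PI].
    apply lim_at_left, continuous_cos.
  - apply lim_C_minus; (apply lim_C_mult; [|apply lim_C_const, _]).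
    + apply (prim_gap_lim_0 _ _ (slope_open w) (kernel2_hol w) HD).
    + apply lim_C_RtoC; [exact _|]. apply (lim_at_right (fun v => v)), continuous_id.
  - apply lim_C_minus; (apply lim_C_mult; [|apply lim_C_const, _]).
    + apply (prim_gap_lim_PI _ _ _ (slope_open w) (kernel2_hol w) HD (kernel2_lim w Hw0)).
    + apply lim_C_RtoC; [exact _|]. apply (lim_at_left (fun v => v)), continuous_id.
  - split; [exact H1|]. rewrite H2. field. repeat split; assumption.
Qed.

Theorem theorem3p5 :
  forall W : C -> C, is_principal_LambertW W ->
  forall z : C, z <> RtoC 0 -> slit_plane 0 z ->
    (C_Rintegrable (integrand1 z) 0 PI /\
     (RtoC 1 / (RtoC 1 + W z))%C
     = (RtoC (1 / PI) * C_RInt (integrand1 z) 0 PI)%C) /\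
    (C_Rintegrable (integrand2 z) 0 PI /\
     (RtoC 1 / W z)%C
     = (RtoC 1 / z + RtoC (1 / PI) * C_RInt (integrand2 z) 0 PI)%C).
Proof.
  intros W HW z Hz HS.
  assert (Hw := lambert_in_region W z HW HS).
  assert (E : (W z * Cexp (W z))%C = z).
  { destruct HW as (_ & H2 & _). apply H2.
    replace z with (RtoC 1 * z)%C by ring. apply slit_plane_segment; [lra | exact HS]. }
  set (w := W z) in *. clearbody w. subst z.
  assert (Hw0 : w <> 0%C) by (intros Z; apply Hz; rewrite Z; ring).
  assert (N : (1 + w)%C <> 0%C) by (rewrite <- slope_diag; apply slope_neq_0; assumption).
  assert (NE := Cexp_neq_0 w).
  assert (PP := PI_RGT_0).
  assert (NP : RtoC PI <> 0%C) by (intros Z; apply RtoC_inj in Z; lra).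
  assert (EP : RtoC (1 / PI) = (/ RtoC PI)%C) by (rewrite <- RtoC_inv by lra; f_equal; field; lra).
  destruct (first_integral w HS Hw) as [A1 A2].
  destruct (second_integral w HS Hw Hw0) as [B1 B2].
  rewrite A2, B2, EP.
  split; (split; [assumption|]).
  - field. split; assumption.
  - field. repeat split; assumption.
Qed.
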